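(* Let $s\geq 1$ be an integer and let $\sigma_{1},\ldots,\sigma_{s}$ be positive integers. For each $1\leq i\leq s$ let $P_{i,1},\ldots,P_{i,\sigma_{i}}\in\mathbb{Z}[X]$ be a set of $\sigma_{i}$ polynomials in one variable of degrees $1=d_{i,1}\leq d_{i,2}\leq\cdots\leq d_{i,\sigma_{i}}$ respectively, where $P_{i,1}(X)=X$ for $1\leq i\leq s$. Let $$t_{i}:=\max_{1\leq j\leq \sigma_{i}-1}(d_{i,j+1}-d_{i,j}),\qquad 1\leq i\leq s,$$ with $t_{i}:=0$ if $\sigma_{i}=1$. Put $k=\sigma_{1}+\cdots+\sigma_{s}$, $d:=\min_{1\leq i\leq s}d_{i,\sigma_{i}}$, $d^{\prime}:=\max_{1\leq i\leq s}d_{i,\sigma_{i}}$ and $t^{\prime}:=\max_{1\leq i\leq s}t_{i}$. Let $$M=\left\{(P_{1,1}(x_{1}),\ldots,P_{1,\sigma_{1}}(x_{1}),P_{2,1}(x_{2}),\ldots,P_{s,\sigma_{s}}(x_{s}))\in\mathbb{R}^{k}:(x_{1},\ldots,x_{s})\in\mathbb{R}^{s}\right\}.$$ Let $\Pi_{(s)}:\mathbb{R}^{k}\to\mathbb{R}^{s}$ denote the projection onto the coordinates with indices $1,\ \sigma_{1}+1,\ \sigma_{1}+\sigma_{2}+1,\ \ldots,\ \sigma_{1}+\cdots+\sigma_{s-1}+1$ (the places of the entries $P_{i,1}(x_{i})=x_{i}$). Then for any parameter $\lambda>t^{\prime}$ we have $$\Pi_{(s)}(\mathscr{H}^{k}_{\lambda}\cap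 M)\subseteq\mathscr{H}^{s}_{d\lambda+d-1},$$ and thus $$\dim(\mathscr{H}^{k}_{\lambda}\cap M)\leq\frac{s+1}{d(\lambda+1)}.$$ If $d=d^{\prime}$, there is equality in both claims, that is, for any $\lambda>t^{\prime}$, $\Pi_{(s)}(\mathscr{H}^{k}_{\lambda}\cap M)=\mathscr{H}^{s}_{d\lambda+d-1}$ and $\dim(\mathscr{H}^{k}_{\lambda}\cap M)=\frac{s+1}{d(\lambda+1)}$.
   Context: $\dim$ denotes Hausdorff dimension. For a real number $x$, $\Vert x\Vert$ denotes the distance of $x$ to the nearest integer. For an integer $m\geq 1$ and a real parameter $\lambda>0$, $\mathscr{H}^{m}_{\lambda}$ is the set of $(\zeta_{1},\ldots,\zeta_{m})\in\mathbb{R}^{m}$ such that for every fixed $\epsilon>0$ the estimate $\max_{1\leq j\leq m}\Vert q\zeta_{j}\Vert\leq q^{-\lambda+\epsilon}$ has arbitrarily large integer solutions $q$. The entries of $M$ are listed in blocks: for each $i$ in order, the $\sigma_{i}$ values $P_{i,1}(x_{i}),\ldots,P_{i,\sigma_{i}}(x_{i})$.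
   Formalization: The final dimension equality is stated for λ ≥ 1/s only; this is automatic unless d = d′ = 1, and for d = d′ = 1 with λ < 1/s the claimed value exceeds s, so the equality fails (e.g. s = 1, P = X, λ = 1/2: dimension 1, not 4/3). *)

(* Defs.v *)
From HB Require Import structures.
From mathcomp Require Import all_boot all_order all_algebra.
From mathcomp Require Import all_classical all_reals all_analysis.
Set Implicit Arguments.
Unset Strict Implicit.
Unset Printing Implicit Defensive.
Import Order.TTheory GRing.Theory Num.Theory.
Import numFieldNormedType.Exports.
Local Open Scope classical_set_scope.
Local Open Scope ring_scope.

Section HausdorffDimension.
Context {R : realType} {n : nat}.
Implicit Types (x y : 'rV[R]_n) (A E : set 'rV[R]_n).

(* The library norm on ['rV_n] is the sup norm; the Euclidean one is used here. *)
Definition eucl_dist x y : R := Num.sqrt (\sum_(i < n) (x 0 i - y 0 i) ^+ 2).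

(* [-oo] on the empty set *)
Definition diam A : \bar R :=
  ereal_sup [set (eucl_dist x y)%:E | x in A & y in A].

(* diam(A)^a with the convention 0 for the empty set; a point has weight 1
   when [a = 0], so that the 0-dimensional measure is the counting measure. *)
Definition diam_pow (a : R) A : \bar R :=
  if A == set0 then 0%E else poweR (diam A) a.

Definition hausdorff_premeasure (a delta : R) E : \bar R :=
  ereal_inf [set (\sum_(0 <= i <oo) diam_pow a (U i))%E | U in
    [set U : nat -> set 'rV[R]_n |
      (forall i, (diam (U i) <= delta%:E)%E) /\ E `<=` \bigcup_i U i]].

Definition hausdorff_measure (a : R) E : \bar R :=
  ereal_sup [set hausdorff_premeasure a delta E | delta in [set delta | 0 < delta]].

Definition hausdorff_dim E : \bar R :=
  ereal_inf [set a%:E | a in [set a : R | 0 <= a /\ hausdorff_measure a E = 0%E]].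

End HausdorffDimension.

Definition dist_int {R : realType} (x : R) : R :=
  inf (range (fun z : int => `|x - z%:~R|)).

Definition approx_set (R : realType) (m : nat) (lambda : R) : set 'rV[R]_m :=
  [set zeta | forall eps : R, 0 < eps -> forall N : nat,
    exists2 q : nat, (N < q)%N &
      \big[Num.max/0]_(j < m) dist_int (q%:R * zeta 0 j)
        <= q%:R `^ (- lambda + eps)].

Definition degp (p : {poly int}) : nat := (size p).-1.

Section PolynomialData.
Context {s : nat} {sigma : 'I_s -> nat}.
Implicit Type P : forall i, (sigma i).-tuple {poly int}.

(* Within a block, indices start from 0: [(P i)`_j] is P_{i,j+1}. *)
Definition last_deg P (i : 'I_s) : nat := degp (P i)`_(sigma i).-1.

(* The truncated subtraction is exact for nondecreasing degrees. *)
Definition gap P (i : 'I_s) : nat :=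
  \max_(j < (sigma i).-1) (degp (P i)`_j.+1 - degp (P i)`_j)%N.

Definition max_gap P : nat := \max_(i < s) gap P i.

Definition max_last_deg P : nat := \max_(i < s) last_deg P i.

(* Starting the iteration at the maximum leaves the minimum unchanged
   (for [0 < s]); [minn] has no neutral element. *)
Definition min_last_deg P : nat :=
  \big[minn/max_last_deg P]_(i < s) last_deg P i.

Definition poly_manifold (R : realType) P : set 'rV[R]_(\sum_(i < s) sigma i) :=
  range (fun x : 'rV[R]_s =>
    \mxrow_(i < s) \row_(j < sigma i) (map_poly intr (P i)`_j).[x 0 i]).

Definition proj_first (R : realType) (sigma_gt0 : forall i, (0 < sigma i)%N)
    (z : 'rV[R]_(\sum_(i < s) sigma i)) : 'rV[R]_s :=
  \row_(i < s) submxrow z i 0 (Ordinal (sigma_gt0 i)).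

End PolynomialData.
Arguments poly_manifold {s sigma} R P.

(* Main.v *)
Require Import Defs.
From HB Require Import structures.
From mathcomp Require Import all_boot all_order all_algebra.
From mathcomp Require Import all_classical all_reals all_analysis.
From mathcomp Require Import ring lra zify.
Set Implicit Arguments.
Unset Strict Implicit.
Unset Printing Implicit Defensive.
Import Order.TTheory GRing.Theory Num.Theory.
Import numFieldNormedType.Exports.
Local Open Scope classical_set_scope.
Local Open Scope ring_scope.

(** Let [x] be a parameter, [Phi x] the point of the manifold above it, and
    suppose that [q] approximates all the coordinates of [Phi x] within
    [q^(-lambda+eps)].

    Inclusion. Because [P_{i,1} = X], some integer [n] makes [n/q] close to
    [x_i]; write it in lowest terms as [a/b].  The value [q P(a/b)] is then close
    to an integer for every polynomial [P] of the block.  Inductively on the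
    index, [b^deg(P)] divides [q] up to a constant made of leading coefficients:
    once this holds for one polynomial, the next value is a rational number with
    denominator at most [b^gap <= q^gap], and being closer than [q^(-gap)] to an
    integer it must be an integer; as [a] and [b] are coprime, [b^deg] of the next
    polynomial divides [q] up to a constant ([block_denominator]).  So [b^d]
    divides a constant multiple of [q] in each block, hence so does [Q^d] for the
    lcm [Q] of the [b]'s ([common_denominator]), and [Q], whose size is at most
    about [q^(1/d)], approximates [x] with exponent [d lambda + d - 1]
    ([approx_set_poly_point_sub]).  If all last degrees are equal to [d], then
    conversely [q = Q^d] works, since [Q^d P(a/Q)] is an integer for each
    polynomial ([approx_set_poly_point_sup]).

    Upper bound. By the inclusion, the set is contained in a locally Lipschitz
    image of the set of points with exponent [mu = d lambda + d - 1], which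
    inside a box is covered, for each [q], by about [q^s] cubes of side about
    [q^(-mu-1)].  Since [mu + 1 = d (lambda + 1)], the sum of the [a]-th powers
    of the diameters converges as soon as [a > (s+1)/(d(lambda+1))]
    ([hausdorff_measure_image_approx_set]).

    Lower bound (theorem of Jarnik and Besicovitch).  The projection is a
    contraction in each coordinate, so it is enough to show that no cover of the
    set of exponent [mu] has a small sum of [a]-th powers, when
    [a < (s+1)/(mu+1)].  Dirichlet's theorem and a count of the points near
    rationals with small denominator show that a cube contains about
    [r^s Q^(s+1)] well separated rational points of denominator comparable to
    [Q] ([many_good_cells]); cubes of side [Q^(-mu-1)] around them are its
    children.  Instead of building a measure on the resulting Cantor set and
    using compactness, a cover is followed down the tree: to each cube is
    attached a total load, which bounds the proportion of the Cantor set in the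
    cube that the cover can take up.  The load of a cube is at least the average
    load of its children ([sum_load_children]), so one can always choose a child
    with load less than 1 ([load_step]).  The point defined by these nested cubes
    has exponent [mu] and is missed by the cover ([exists_avoiding_point]). *)

(** * Powers and geometric sequences *)

Lemma geometric_eventually_le (R : realType) (c rho eta : R) :
  0 <= rho < 1 -> 0 < eta -> exists K, forall k, (K <= k)%N -> c * rho ^+ k <= eta.
Proof.
move=> /andP[rho0 rho1] eta0.
have : geometric c rho k @[k --> \oo] --> (0 : R).
  by apply: cvg_geometric; rewrite ger0_norm.
move=> /cvgrPdist_le/(_ eta eta0) [K _ tail]; exists K => k Kk.
by have := tail k Kk; rewrite /= sub0r normrN; apply: le_trans; exact: ler_norm.
Qed.

Lemma powR_expr (R : realType) (b x : R) m : 0 <= b ->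
  (b ^+ m) `^ x = (b `^ x) ^+ m.
Proof.
by move=> b0; rewrite -(powR_mulrn m b0) -(powR_mulrn m (powR_ge0 b x)) powRAC.
Qed.

Lemma powR_addr (R : realType) (b x y : R) : 0 < b ->
  b `^ (x + y) = b `^ x * b `^ y.
Proof. by move=> b0; rewrite powRD // lt0r_neq0 // implybT. Qed.

Lemma powR_eventually_gt (R : realType) (K x : R) : 0 < x ->
  exists N : nat, forall q : nat, (N < q)%N -> K < q%:R `^ x.
Proof.
move=> x0; exists (Num.trunc (Num.max K 1 `^ x^-1)).+1 => q Nq.
have K1 : 0 <= Num.max K 1 by rewrite le_max ler01 orbT.
apply: (@le_lt_trans _ _ (Num.max K 1)); first by rewrite le_max lexx.
have -> : Num.max K 1 = (Num.max K 1 `^ x^-1) `^ x.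
  by rewrite -powRrM mulVf ?lt0r_neq0 // powRr1.
apply: gt0_ltr_powR; rewrite ?nnegrE ?powR_ge0 //.
by apply: lt_le_trans (truncnS_gt _) _; rewrite ler_nat ltnW.
Qed.

(** * Hausdorff measure *)

Section Diameter.
Context {R : realType} {n : nat}.
Implicit Types (x y : 'rV[R]_n) (A : set 'rV[R]_n).

Lemma le_eucl_dist x y j : `|x 0 j - y 0 j| <= eucl_dist x y.
Proof.
rewrite -sqrtr_sqr ler_wsqrtr // (bigD1 j) //= lerDl.
by apply: sumr_ge0 => i _; exact: sqr_ge0.
Qed.

Lemma eucl_dist_le x y (e : R) : 0 <= e ->
  (forall j, `|x 0 j - y 0 j| <= e) -> eucl_dist x y <= n%:R * e.
Proof.
move=> e0 xye; rewrite -[leRHS]ger0_norm ?mulr_ge0 // -sqrtr_sqr ler_wsqrtr //.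
apply: (@le_trans _ _ (\sum_(i < n) e ^+ 2)).
  apply: ler_sum => i _; rewrite -[leLHS]real_normK ?num_real//.
  by rewrite lerXn2r ?nnegrE.
rewrite sumr_const card_ord exprMn -[leLHS]mulr_natl ler_wpM2r ?sqr_ge0 //.
by rewrite -natrX ler_nat; case: (n) => // k; rewrite -mulnn leq_pmulr.
Qed.

Lemma diam_ge0 A : A !=set0 -> (0 <= diam A)%E.
Proof.
move=> [x Ax]; apply: ereal_sup_ge; exists (eucl_dist x x)%:E; first by exists x => //; exists x.
by rewrite lee_fin sqrtr_ge0.
Qed.

Lemma diam_le A (e : R) :
  (forall x y, A x -> A y -> eucl_dist x y <= e) -> (diam A <= e%:E)%E.
Proof.
by move=> Ae; apply: ub_ereal_sup => _ [x Ax [y Ay <-]]; rewrite lee_fin Ae.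
Qed.

Lemma diam_pow_le A (a e : R) : 0 <= a -> 0 <= e ->
  (diam A <= e%:E)%E -> (diam_pow a A <= (e `^ a)%:E)%E.
Proof.
move=> a0 e0 Ae; rewrite /diam_pow; case: ifPn => [_|/set0P A0].
  by rewrite lee_fin powR_ge0.
rewrite -poweR_EFin; apply: gt0_ler_poweR => //.
  by rewrite in_itv /= diam_ge0 // leey.
by rewrite in_itv /= lee_fin e0 leey.
Qed.

Lemma diam_pow_ge A (a : R) x y : 0 <= a ->
  A x -> A y -> ((eucl_dist x y `^ a)%:E <= diam_pow a A)%E.
Proof.
move=> a0 Ax Ay; rewrite /diam_pow ifF; last first.
  by apply/negbTE/set0P; exists x.
rewrite -poweR_EFin; apply: gt0_ler_poweR => //.
- by rewrite in_itv /= lee_fin sqrtr_ge0 leey.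
- by rewrite in_itv /= diam_ge0 ?leey //; exists x.
- by apply: ereal_sup_ubound; exists x => //; exists y.
Qed.

End Diameter.

Section HausdorffMeasure.
Context {R : realType} {n : nat}.
Implicit Types (A B E : set 'rV[R]_n) (a delta : R).
Local Open Scope ereal_scope.

Lemma diam_pow_ge0 a A : 0 <= diam_pow a A.
Proof. by rewrite /diam_pow; case: ifP => // _; exact: poweR_ge0. Qed.

Lemma diam_pow0 a : diam_pow a (set0 : set 'rV[R]_n) = 0.
Proof. by rewrite /diam_pow eqxx. Qed.

Lemma diam0 : diam (set0 : set 'rV[R]_n) = -oo.
Proof.
by rewrite /diam (_ : [set _ | _ in _ & _ in _] = set0) ?ereal_sup0// -subset0 => x [].
Qed.

Lemma hausdorff_premeasure_ge0 a delta E : 0 <= hausdorff_premeasure a delta E.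
Proof.
apply: le_ereal_inf_tmp => _ [U _ <-]; apply: nneseries_ge0 => i _ _.
exact: diam_pow_ge0.
Qed.

Lemma le_hausdorff_premeasure a delta A B :
  A `<=` B -> hausdorff_premeasure a delta A <= hausdorff_premeasure a delta B.
Proof.
move=> AB; apply: ereal_inf_le_tmp => _ [U [dU BU] <-]; exists U => //.
by split=> //; exact: subset_trans AB BU.
Qed.

(** With every set declared measurable, and sets wider than [delta] given
    infinite weight, the premeasure becomes the outer measure generated by a
    set function, and its countable subadditivity is that of [mu_ext]. *)
Let discrete := g_sigma_algebraType [set: set 'rV[R]_n].

Let measurable_discrete (A : set discrete) : measurable A.
Proof. exact: sub_sigma_algebra. Qed.

Let gauge a delta (A : set discrete) : \bar R :=
  if diam (A : set 'rV[R]_n) <= delta%:E then diam_pow a A else +oo.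

Let gauge_ge0 a delta A : 0 <= gauge a delta A.
Proof. by rewrite /gauge; case: ifP => // _; exact: diam_pow_ge0. Qed.

Let hausdorff_premeasureE a delta E :
  hausdorff_premeasure a delta E = mu_ext (gauge a delta) E.
Proof.
apply/eqP; rewrite eq_le; apply/andP; split; apply: le_ereal_inf_tmp => _ [U [UU EU] <-].
  have [dU|] := pselect (forall i, diam (U i : set 'rV[R]_n) <= delta%:E).
    apply: ereal_inf_lbound; exists U => //.
    by apply: eq_eseriesr => i _; rewrite /gauge dU.
  move=> /existsNP[i /negP ndU]; rewrite (@eseries_pinfty _ _ xpredT i) ?leey//.
    by move=> j _; rewrite -ltNye (lt_le_trans _ (gauge_ge0 _ _ _)).
  by rewrite /gauge (negbTE ndU).
apply: ereal_inf_lbound; exists U.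
  by split=> // i; exact: measurable_discrete.
by apply: eq_eseriesr => i _; rewrite /gauge UU.
Qed.

Lemma hausdorff_premeasure_sigma_subadditive a delta (E : nat -> set 'rV[R]_n) :
  hausdorff_premeasure a delta (\bigcup_i E i) <=
  \sum_(0 <= i <oo) hausdorff_premeasure a delta (E i).
Proof.
rewrite hausdorff_premeasureE.
under eq_eseriesr do rewrite hausdorff_premeasureE.
exact: (@mu_ext_sigma_subadditive _ discrete _ _ (gauge_ge0 a delta) E).
Qed.

Lemma hausdorff_premeasure_le_diam_pow a delta A :
  diam A <= delta%:E -> hausdorff_premeasure a delta A <= diam_pow a A.
Proof.
move=> dA; pose U (i : nat) : set 'rV[R]_n := if i is 0%N then A else set0.
apply: ereal_inf_lbound; exists U; first split.
- by case=> //= i; rewrite diam0 leNye.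
- by move=> x Ax; exists 0%N.
rewrite nneseries_recl //; last by move=> i _; exact: diam_pow_ge0.
rewrite /= eseries0 ?adde0// => i i1 _; case: i i1 => //= i _.
exact: diam_pow0.
Qed.

Lemma hausdorff_premeasure0 a delta :
  hausdorff_premeasure a delta (set0 : set 'rV[R]_n) = 0.
Proof.
apply/eqP; rewrite eq_le hausdorff_premeasure_ge0 andbT -(diam_pow0 a).
by apply: hausdorff_premeasure_le_diam_pow; rewrite diam0 leNye.
Qed.

Lemma hausdorff_premeasure_fin_subadditive a delta (I : finType)
    (F : I -> set 'rV[R]_n) :
  hausdorff_premeasure a delta (\bigcup_i F i) <=
  \sum_i hausdorff_premeasure a delta (F i).
Proof.
pose E (k : nat) : set 'rV[R]_n := if insub k is Some o then F (enum_val (o : 'I_#|I|)) else set0.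
have -> : \bigcup_i F i = \bigcup_k E k.
  apply/seteqP; split=> x [i _ Fx].
    by exists (val (enum_rank i)) => //; rewrite /E valK enum_rankK.
  by move: Fx; rewrite /E; case: insubP => // o _ _ Fx; exists (enum_val o).
apply: (le_trans (hausdorff_premeasure_sigma_subadditive _ _ _)).
rewrite (nneseries_split _ #|I|); last by move=> k _; exact: hausdorff_premeasure_ge0.
rewrite add0n [X in _ + X]eseries0 => [|k kI _]; last first.
  by rewrite /E insubF ?hausdorff_premeasure0 // ltnNge kI.
rewrite adde0 big_mkord (reindex (@enum_val I predT)) /=; last first.
  by apply: onW_bij; exact: enum_val_bij.
by apply: lee_sum => o _; rewrite /E valK.
Qed.

Lemma hausdorff_measure_eq0 a E :
  (forall delta eta : R, (0 < delta)%R -> (0 < eta)%R ->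
    hausdorff_premeasure a delta E <= eta%:E) -> hausdorff_measure a E = 0.
Proof.
move=> small; apply/eqP; rewrite eq_le; apply/andP; split.
  apply: ub_ereal_sup => _ [delta delta0 <-].
  by apply/lee_addgt0Pr => eta eta0; rewrite add0e; exact: small.
apply: (le_trans (hausdorff_premeasure_ge0 a 1 E)).
by apply: ereal_sup_ubound; exists 1%R => //=; exact: ltr01.
Qed.

End HausdorffMeasure.

Section HausdorffNull.
Context {R : realType} {n : nat}.
Implicit Types (A B E : set 'rV[R]_n) (a delta : R).
Local Open Scope ereal_scope.

Lemma hausdorff_premeasure_le_measure a delta E : (0 < delta)%R ->
  hausdorff_premeasure a delta E <= hausdorff_measure a E.
Proof. by move=> delta0; apply: ereal_sup_ubound; exists delta. Qed.

Lemma hausdorff_measure_bigcup_eq0 a (E : nat -> set 'rV[R]_n) :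
  (forall i, hausdorff_measure a (E i) = 0) ->
  hausdorff_measure a (\bigcup_i E i) = 0.
Proof.
move=> E0; apply: hausdorff_measure_eq0 => delta eta delta0 eta0.
apply: (le_trans (hausdorff_premeasure_sigma_subadditive _ _ _)).
rewrite eseries0 ?lee_fin ?ltW// => i _ _.
apply/eqP; rewrite eq_le hausdorff_premeasure_ge0 andbT -(E0 i).
exact: hausdorff_premeasure_le_measure.
Qed.

(** The convergence part of the Borel-Cantelli argument: a point that belongs
    to sets of infinitely many stages is covered by the stages after any given
    [K], whose total weight is a geometric tail. *)
Lemma hausdorff_measure_limsup_eq0 a (c rho : R) (I : nat -> finType)
    (F : forall k, I k -> set 'rV[R]_n) E :
  (0 <= rho < 1)%R -> (0 <= c)%R ->
  (forall k, \sum_i diam_pow a (F k i) <= (c * rho ^+ k)%:E) ->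
  (forall delta, (0 < delta)%R -> exists K, forall k i, (K <= k)%N ->
    diam (F k i) <= delta%:E) ->
  (forall x K, E x -> exists k i, (K <= k)%N /\ F k i x) ->
  hausdorff_measure a E = 0.
Proof.
move=> /andP[rho0 rho1] c0 sumF diamF coverF.
apply: hausdorff_measure_eq0 => delta eta delta0 eta0.
have [K0 diamK0] := diamF _ delta0.
have rho1' : (0 < 1 - rho)%R by rewrite subr_gt0.
have [K K0K tailK] : exists2 K, (K0 <= K)%N & (c * rho ^+ K <= eta * (1 - rho))%R.
  have : geometric c rho k @[k --> \oo] --> (0 : R)%R.
    by apply: cvg_geometric; rewrite ger0_norm.
  move=> /cvgrPdist_le/(_ (eta * (1 - rho))%R).
  move=> /(_ (mulr_gt0 eta0 rho1')) [K _ tail].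
  exists (maxn K0 K); rewrite ?leq_maxl//.
  have := tail (maxn K0 K) (leq_maxr _ _); rewrite /= sub0r normrN.
  by rewrite ger0_norm // mulr_ge0 // exprn_ge0.
have EF : E `<=` \bigcup_j \bigcup_i F (K + j)%N i.
  move=> x Ex; have [k [i [Kk Fx]]] := coverF x K Ex.
  by exists (k - K)%N => //; rewrite subnKC //; exists i.
apply: (le_trans (le_hausdorff_premeasure _ _ EF)).
apply: (le_trans (hausdorff_premeasure_sigma_subadditive _ _ _)).
apply: lime_le; first by apply: is_cvg_nneseries => k _ _; exact: hausdorff_premeasure_ge0.
near=> m; apply: (@le_trans _ _ (\sum_(0 <= j < m) (c * rho ^+ (K + j))%:E)).
  apply: lee_sum => j _; apply: le_trans (sumF (K + j)%N).
  apply: (le_trans (hausdorff_premeasure_fin_subadditive _ _ _)).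
  apply: lee_sum => i _; apply: hausdorff_premeasure_le_diam_pow.
  by apply: diamK0; rewrite (leq_trans K0K) ?leq_addr.
rewrite sumEFin lee_fin.
have -> : (\sum_(0 <= j < m) c * rho ^+ (K + j) =
           c * rho ^+ K * ((1 - rho ^+ m) / (1 - rho)))%R.
  under eq_bigr do rewrite exprD mulrA.
  rewrite -mulr_sumr big_mkord; congr (_ * _)%R.
  apply: (mulIf (lt0r_neq0 rho1')); rewrite divfK ?gt_eqF //.
  by rewrite -[RHS]opprB subrX1 -mulNr opprB mulrC.
rewrite mulrA ler_pdivrMr //; apply: le_trans tailK.
rewrite -[leRHS]mulr1 ler_wpM2l // ?mulr_ge0 ?exprn_ge0 //.
by rewrite gerBl exprn_ge0.
Unshelve. all: by end_near. Qed.

End HausdorffNull.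

Lemma le_hausdorff_measure (R : realType) (n : nat) (a : R) (A B : set 'rV[R]_n) :
  A `<=` B -> (hausdorff_measure a A <= hausdorff_measure a B)%E.
Proof.
move=> AB; apply: ub_ereal_sup => _ [delta delta0 <-].
exact: le_trans (le_hausdorff_premeasure _ _ AB) (hausdorff_premeasure_le_measure _ _ delta0).
Qed.

Lemma hausdorff_measure_ge0 (R : realType) (n : nat) (a : R) (A : set 'rV[R]_n) :
  (0 <= hausdorff_measure a A)%E.
Proof.
exact: le_trans (hausdorff_premeasure_ge0 a 1 A) (hausdorff_premeasure_le_measure _ _ ltr01).
Qed.

Lemma hausdorff_dim_le (R : realType) (n : nat) (A : set 'rV[R]_n) (D : R) : 0 <= D ->
  (forall a, D < a -> hausdorff_measure a A = 0%E) -> (hausdorff_dim A <= D%:E)%E.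
Proof.
move=> D0 null; apply/lee_addgt0Pr => e e0; apply: ereal_inf_lbound.
exists (D + e) => //; split; first by rewrite addr_ge0 // ltW.
by apply: null; rewrite ltrDl.
Qed.

Lemma hausdorff_dim_ge (R : realType) (n : nat) (A : set 'rV[R]_n) (D : R) :
  (forall a, 0 <= a < D -> hausdorff_measure a A <> 0%E) -> (D%:E <= hausdorff_dim A)%E.
Proof.
move=> pos; apply: le_ereal_inf_tmp => _ [a [a0 null] <-].
by rewrite lee_fin leNgt; apply/negP => aD; apply: pos null; rewrite a0.
Qed.

(** * Distance to the nearest integer *)

Section DistInt.
Context {R : realType}.
Implicit Types x : R.

Lemma dist_int_le x (z : int) : dist_int x <= `|x - z%:~R|.
Proof.
apply: ge_inf; last by exists z.
by exists 0 => _ [y _ <-].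
Qed.

(** The infimum that defines [dist_int] is a minimum, reached at one of the two
    integers around [x]. *)
Lemma dist_int_attained x : exists2 p : int, `|x - p%:~R| <= dist_int x & `|x - p%:~R| <= 2^-1.
Proof.
have /andP[] := floor_itv x; set f := Num.floor x => fx xf.
rewrite intrD /= in xf.
have far z : Num.min (x - f%:~R) (f%:~R + 1 - x) <= `|x - z%:~R|.
  have [zf|fz] := leP z f.
    have : (z%:~R : R) <= f%:~R by rewrite ler_int.
    by move=> zf'; rewrite ge_min ler_normr; apply/orP; left; apply/orP; left; lra.
  have : (f%:~R + 1 : R) <= z%:~R by rewrite -[1]/(1%:~R) -intrD ler_int lezD1.
  by move=> fz'; rewrite ge_min; apply/orP; right; rewrite ler_normr; apply/orP; right; lra.
have minle : Num.min (x - f%:~R) (f%:~R + 1 - x) <= dist_int x.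
  by apply: lb_le_inf; [exists `|x - 0%:~R|; exists 0|move=> _ [z _ <-]].
move: minle; have [le1|lt1] := leP (x - f%:~R) (f%:~R + 1 - x) => minle.
  by exists f; rewrite ger0_norm; lra.
by exists (f + 1) => //; rewrite intrD /= ler0_norm; lra.
Qed.

End DistInt.

(** The form of [approx_set] in which the nearest integers are explicit; all
    later arguments produce or consume these integers. *)
Lemma approx_setP (R : realType) (m : nat) (lambda : R) (zeta : 'rV[R]_m) :
  approx_set lambda zeta <->
  forall eps : R, 0 < eps -> forall N : nat, exists2 q : nat, (N < q)%N &
    exists p : 'I_m -> int,
      forall j, `|q%:R * zeta 0 j - (p j)%:~R| <= q%:R `^ (- lambda + eps).
Proof.
split=> appr eps eps0 N; have [q Nq] := appr eps eps0 N.
  move=> close; exists q => //.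
  have ex j : exists p : int, `|q%:R * zeta 0 j - p%:~R| <= q%:R `^ (- lambda + eps).
    have [p ple _] := dist_int_attained (q%:R * zeta 0 j); exists p.
    by apply: (le_trans ple); apply: le_trans close; exact: le_bigmax_cond.
  by have [p pP] := choice ex; exists p.
move=> [p close]; exists q => //; apply: bigmax_le => [|j _]; first exact: powR_ge0.
exact: (le_trans (dist_int_le _ (p j))).
Qed.

(** * Covering the points of a given approximation exponent *)

Section UpperBound.
Context {R : realType} {s k : nat}.

(** Lipschitz on each box, measured from the sup distance to the Euclidean
    one. *)
Definition locally_lipschitz (Phi : 'rV[R]_s -> 'rV[R]_k) := forall B : nat,
  exists2 L : R, 0 < L & forall (x y : 'rV[R]_s) (e : R), 0 <= e ->
    (forall j, `|x 0 j| <= B%:R) -> (forall j, `|y 0 j| <= B%:R) ->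
    (forall j, `|x 0 j - y 0 j| <= e) -> eucl_dist (Phi x) (Phi y) <= L * e.

(** The points of exponent [mu] in a box are, for infinitely many [q], within
    [q^(-beta)] of a rational point of denominator [q], for any
    [beta < mu + 1].  Grouping the [q]'s in [2^m, 2^(m+1)) gives about
    [2^(m(s+1))] sets of diameter of order [2^(-m beta)]; their [a]-th powers
    sum to a geometric sequence once [beta a > s + 1]. *)
Lemma hausdorff_measure_image_approx_set (Phi : 'rV[R]_s -> 'rV[R]_k) (mu a : R) :
  locally_lipschitz Phi -> 0 < mu -> (s%:R + 1) / (mu + 1) < a ->
  hausdorff_measure a (Phi @` approx_set mu) = 0%E.
Proof.
move=> lipPhi mu0 lt_a.
have mu1 : 0 < mu + 1 by lra.
have s0 : 0 <= s%:R :> R by [].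
have s1 : 0 < s%:R + 1 :> R by lra.
have a_gt0 : 0 < a by apply: lt_trans lt_a; exact: divr_gt0.
have [beta [beta1 betaa betamu]] :
    exists beta, [/\ 1 < beta, s%:R + 1 < beta * a & beta < mu + 1].
  have sa : (s%:R + 1) / a < mu + 1.
    by rewrite ltr_pdivrMr // mulrC -ltr_pdivrMr.
  (* beta > 1 makes the error q^(1-beta) on a numerator at most 1 *)
  exists ((mu + 1 + Num.max 1 ((s%:R + 1) / a)) / 2).
  by have [c|c] := leP 1 ((s%:R + 1) / a); split; rewrite -1?(ltr_pdivrMr _ _ a_gt0); lra.
have beta0 : 0 < beta by lra.
pose E (B : nat) := Phi @` [set x | approx_set mu x /\ forall j, `|x 0 j| <= B%:R].
have -> : Phi @` approx_set mu = \bigcup_B E B.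
  apply/seteqP; split=> [_ [x xmu <-]|_ [B _ [x [xmu _] <-]]]; last by exists x.
  exists (Num.trunc (\big[Num.max/0]_j `|x 0 j|)).+1 => //; exists x => //; split=> // j.
  apply/ltW; apply: le_lt_trans (truncnS_gt _).
  by apply: (le_bigmax_cond _ (fun j => `|x 0 j|)).
apply: hausdorff_measure_bigcup_eq0 => B.
have [L L0 lip] := lipPhi B.
(* A numerator is shifted by B * 2^(m+1) + 1 to become a natural number; the
   denominators of stage m are 2^m + u.1 with u.1 < 2^m. *)
pose N m := ((4 * B + 3) * 2 ^ m)%N.
pose I m : finType := ('I_(2 ^ m) * {ffun 'I_s -> 'I_(N m)})%type.
pose num m (u : I m) (j : 'I_s) : R := (u.2 j)%:R - (B%:R * 2 * 2 ^+ m + 1).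
pose den m (u : I m) : R := 2 ^+ m + (u.1)%:R.
pose e m : R := (2 ^+ m) `^ (- beta).
pose F m (u : I m) : set 'rV[R]_k := Phi @` [set x : 'rV[R]_s | (forall j, `|x 0 j| <= B%:R) /\
    forall j, `|x 0 j - num m u j / den m u| <= e m].
have e0 m : 0 <= e m by exact: powR_ge0.
have two0 m : 0 < (2 : R) ^+ m by rewrite exprn_gt0.
have two1 m : 1 <= (2 : R) ^+ m by rewrite exprn_ege1 // ler1n.
have diamF m u : (diam (F m u) <= (L * (2 * e m))%:E)%E.
  apply: diam_le => _ _ [x [xB xu] <-] [y [yB yu] <-]; apply: lip => //.
    by rewrite mulr_ge0.
  move=> j; have := xu j; have := yu j; rewrite !ler_norml; lra.
pose rho : R := 2 `^ (s%:R + 1 - beta * a).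
have powlt1 (x : R) : x < 0 -> 0 <= (2 : R) `^ x < 1.
  move=> x0; rewrite powR_ge0 /= -[x]opprK powRN invf_lt1 ?powR_gt0 //.
  have nx0 : 0 < - x by rewrite oppr_gt0.
  by have := gt0_ltr_powR nx0 (ler01 : 1 \in Num.nneg) (ler0n R 2) (ltr1n R 2); rewrite powR1.
have eE m : e m = (2 `^ (- beta)) ^+ m.
  exact: powR_expr.
apply: (@hausdorff_measure_limsup_eq0 _ _ a ((L * 2) `^ a * (4 * B + 3)%:R ^+ s) rho I F).
- by apply: powlt1; lra.
- by rewrite mulr_ge0 ?powR_ge0 ?exprn_ge0.
- move=> m; apply: (@le_trans _ _ (\sum_(u : I m) (((L * 2) * e m) `^ a)%:E)).
    apply: lee_sum => u _; apply: diam_pow_le; first exact: ltW.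
      by rewrite !mulr_ge0 // ltW.
    by rewrite -mulrA.
  rewrite sumEFin lee_fin sumr_const card_prod card_ffun !card_ord.
  have ea : e m `^ a = (2 `^ (- (beta * a))) ^+ m.
    by rewrite eE powR_expr ?powR_ge0 // -powRrM mulNr.
  rewrite -[leLHS]mulr_natl natrM !natrX natrM powRM //; last by rewrite mulr_ge0 // ltW.
  rewrite ea /rho !powR_addr //.
  rewrite powRr1 // powR_mulrn // !exprMn natrX -!exprM [(m * s)%N]mulnC.
  rewrite le_eqVlt; apply/orP; left; apply/eqP; ring.
- move=> delta delta0.
  have nbeta0 : - beta < 0 by rewrite oppr_lt0.
  have [K tail] := geometric_eventually_le (L * 2) (powlt1 _ nbeta0) delta0.
  exists K => m u Km; apply: (le_trans (diamF m u)).
  by rewrite lee_fin mulrA eE tail.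
- move=> _ K [x [/approx_setP xmu xB] <-].
  have eps0 : 0 < mu + 1 - beta by lra.
  have [q Kq [p close]] := xmu _ eps0 (2 ^ K)%N.
  have q0 : (0 < q)%N by exact: leq_ltn_trans Kq.
  pose m := trunc_log 2 q.
  have /andP[mq qm] := trunc_log_bounds (isT : 1 < 2)%N q0.
  rewrite -/m in mq qm.
  have qmR : q%:R <= 2 * 2 ^+ m :> R by rewrite -exprS -natrX ler_nat ltnW.
  have mqR : 2 ^+ m <= q%:R :> R by rewrite -natrX ler_nat.
  have qR0 : 0 < q%:R :> R by rewrite ltr0n.
  have q1R : 1 <= q%:R :> R by rewrite ler1n.
  have pB j : `|(p j)%:~R| <= B%:R * 2 * 2 ^+ m + 1 :> R.
    have qx1 : `|q%:R * x 0 j - (p j)%:~R| <= 1.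
      apply: (le_trans (close j)); rewrite -[leRHS](powRr0 q%:R) ler_powR //; lra.
    have qxB : `|q%:R * x 0 j| <= 2 * 2 ^+ m * B%:R.
      by rewrite normrM ger0_norm // ler_pM.
    move: qx1 qxB; rewrite !ler_norml; lra.
  have exo j : exists o : 'I_(N m), o%:R = (p j)%:~R + (B%:R * 2 * 2 ^+ m + 1) :> R.
    pose v := p j + (B * 2 * 2 ^ m + 1)%N%:Z.
    have vE : v%:~R = (p j)%:~R + (B%:R * 2 * 2 ^+ m + 1) :> R.
      by rewrite /v intrD /= -[(_%N%:Z)%:~R]/(_%:R) natrD !natrM natrX.
    have v0 : (`|v|%N)%:Z = v.
      by apply: gez0_abs; rewrite -(ler0z R) vE; have := pB j; rewrite ler_norml; lra.
    have vN : (`|v| < N m)%N.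
      rewrite -ltz_nat v0 -(ltr_int R) vE -[(N m)%:~R]/((N m)%:R) /N natrM natrD natrM natrX.
      by have := two1 m; have := pB j; rewrite ler_norml; nra.
    by exists (Ordinal vN); rewrite -vE -[in RHS]v0.
  have [w wP] := choice exo.
  have q2 : (q - 2 ^ m < 2 ^ m)%N by rewrite ltn_subLR // addnn -mul2n -expnS.
  exists m, (Ordinal q2, [ffun j => w j]); split.
    by rewrite -ltnS -(@ltn_exp2l 2) // (ltn_trans Kq).
  exists x => //; split=> // j.
  rewrite /num /den /= ffunE wP natrB // natrX addrK subrKC.
  have -> : x 0 j - (p j)%:~R / q%:R = (q%:R * x 0 j - (p j)%:~R) / q%:R.
    by field; rewrite gt_eqF.
  rewrite normrM normfV (ger0_norm (ltW qR0)) ler_pdivrMr //.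
  apply: (le_trans (close j)).
  have -> : - mu + (mu + 1 - beta) = - beta + 1 by ring.
  rewrite powR_addr // powRr1 // ler_wpM2r //.
  rewrite /e !powRN lef_pV2 ?posrE ?powR_gt0 //.
  by rewrite ge0_ler_powR ?nnegrE // ltW.
Qed.

End UpperBound.

(** * Values of integer polynomials at rational points *)

Lemma intr_norm_lt1 (R : realType) (z : int) : `|z%:~R : R| < 1 -> z = 0.
Proof. by rewrite -intr_norm -[1]/(1%:~R) ltr_int; lia. Qed.

(** This is how divisibility passes from the value [N] of [b^d p(a/b)] to the
    leading coefficient [c] of [p]: modulo [b], [N] is [c a^d] with [a]
    invertible, so [c = u N + b e] for some [u] and [e], and [c^d] is
    [(b e)^d] up to a multiple of [N]. *)
Lemma coprimez_dvdz_exp_lead (a b c q N : int) (d : nat) : coprimez a b ->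
  (b %| N - c * a ^+ d)%Z -> (b ^+ d %| q * N)%Z -> (b ^+ d %| q * c ^+ d)%Z.
Proof.
move=> ab bN bqN.
have /coprimezP[[u v] /= uv] : coprimez (a ^+ d) b by rewrite coprimezXl.
have /dvdzP[w Nw] := bN.
have NE : N = c * a ^+ d + w * b by rewrite -Nw addrC subrK.
have -> : c = u * N + b * (c * v - u * w).
  by rewrite -[LHS]mulr1 -uv NE; ring.
set e := c * v - _; rewrite -[(_ + _) ^+ d](subrK ((b * e) ^+ d)) mulrDr.
rewrite subrXX addrK; apply: rpredD.
  set S := \sum_(_ < d) _; rewrite (_ : _ * _ = q * N * (u * S)); last by ring.
  exact: dvdz_mulr.
by rewrite exprMn mulrCA; exact: dvdz_mulr.
Qed.

(** After multiplication by [b^deg], all terms of [p(a/b)] but the leading one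
    are divisible by [b]. *)
Lemma poly_rational_value (R : realType) (p : {poly int}) (a : int) (b : nat) :
  (0 < b)%N -> exists2 N : int,
    b%:R ^+ degp p * (map_poly intr p).[a%:~R / b%:R] = N%:~R :> R &
    (b %| N - lead_coef p * a ^+ degp p)%Z.
Proof.
move=> b0; set d := degp p.
exists (\sum_(i < d.+1) p`_i * a ^+ i * b%:Z ^+ (d - i)).
  have pd : (size (map_poly (intr : int -> R) p) <= d.+1)%N.
    by rewrite (leq_trans (size_poly _ _)) // /d /degp; case: (size p).
  rewrite (horner_coef_wide _ pd) mulr_sumr rmorph_sum /=.
  apply: eq_bigr => i _; rewrite coef_map /= !rmorphM !rmorphXn /=.
  rewrite -[((b%:Z)%:~R)]/(b%:R : R) expr_div_n.
  have -> : b%:R ^+ d = b%:R ^+ (d - i) * b%:R ^+ i :> R by rewrite -exprD subnK // leq_ord.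
  by field; rewrite expf_neq0 // pnatr_eq0 -lt0n.
rewrite big_ord_recr /= subnn expr0 mulr1 -[lead_coef p]/(p`_d) addrK.
apply: rpred_sum => i _; apply: dvdz_mull; by rewrite dvdz_exp // subn_gt0 ltn_ord.
Qed.

(** The constant up to which [b^deg] of the [j]-th polynomial divides [q] is
    the value at [j.+1]. *)
Definition lead_prod (ps : seq {poly int}) (j : nat) : int :=
  \prod_(i < j) lead_coef ps`_i ^+ degp ps`_i.

(** Induction on [j].  If [q A = m b^d] with [A] the current constant, then
    [A q p(a/b) = m N / b^(d'-d)] for the next polynomial [p] of degree [d'], a
    fraction of denominator at most [q^t].  The hypothesis says that it is closer
    than [q^(-t)] to an integer, so [q N] is divisible by [b^d']; then
    [coprimez_dvdz_exp_lead] applies. *)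
Lemma block_denominator (R : realType) (ps : seq {poly int}) (t q b : nat)
    (a : int) (n : nat -> int) :
  ps`_0 = 'X -> sorted leq [seq degp p | p <- ps] ->
  (forall j, (j.+1 < size ps)%N -> (degp ps`_j.+1 - degp ps`_j <= t)%N) ->
  (0 < q)%N -> (b %| q)%N -> coprimez a b ->
  (forall j, (j < size ps)%N ->
    `|lead_prod ps j|%:~R * q%:R ^+ t *
      `|q%:R * (map_poly intr ps`_j).[a%:~R / b%:R] - (n j)%:~R| < 1 :> R) ->
  forall j, (j < size ps)%N -> (b%:Z ^+ degp ps`_j %| q%:Z * lead_prod ps j.+1)%Z.
Proof.
move=> ps0 ps_sorted gap q0 bq ab close.
have b0 : (0 < b)%N by exact: dvdn_gt0 bq.
have degX : degp 'X = 1%N by rewrite /degp size_polyX.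
have deg_mono j : (j.+1 < size ps)%N -> (degp ps`_j <= degp ps`_j.+1)%N.
  move=> jps; have := sortedP 0%N ps_sorted j; rewrite size_map => /(_ jps).
  by rewrite !(nth_map 0) // ltnW.
have deg_gt0 j : (j < size ps)%N -> (0 < degp ps`_j)%N.
  elim: j => [|j IH] jps; first by rewrite ps0 degX.
  by rewrite (leq_trans (IH (ltnW jps))) // deg_mono.
have lead0 j : (j < size ps)%N -> lead_coef ps`_j != 0.
  by move=> /deg_gt0; rewrite lead_coef_eq0; apply: contraTneq => ->; rewrite /degp size_poly0.
have lead_prod0 j : (j <= size ps)%N -> lead_prod ps j != 0.
  move=> jps; apply/prodf_neq0 => i _; rewrite expf_neq0 // lead0 //.
  exact: leq_trans (ltn_ord i) jps.
elim=> [|j IH] jps.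
  by rewrite ps0 degX expr1 dvdz_mulr.
have {IH} /dvdzP[m mE] := IH (ltnW jps).
set A := lead_prod ps j.+1 in mE *.
have A0 : A != 0 by apply: lead_prod0; exact: ltnW.
have [N NE bN] := poly_rational_value R ps`_j.+1 a b0.
set d' := degp ps`_j.+1 in NE bN *; set d := degp ps`_j in mE.
have dd' : (d <= d')%N by exact: deg_mono.
have b0R : (b%:R : R) != 0 by rewrite pnatr_eq0 -lt0n.
suff qN : q%:Z * N = n j.+1 * b%:Z ^+ d'.
  rewrite /lead_prod big_ord_recr /= -/(lead_prod ps j.+1) -/A -/d' mulrA mulrAC.
  apply: dvdz_mulr; apply: (coprimez_dvdz_exp_lead ab bN).
  by rewrite qN dvdz_mull.
have mN : m * N = A * n j.+1 * b%:Z ^+ (d' - d).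
  apply/eqP; rewrite -subr_eq0; apply/eqP/(@intr_norm_lt1 R); rewrite rmorphB /= !rmorphM /= rmorphXn /=.
  apply: le_lt_trans (close j.+1 jps).
  have -> : m%:~R * N%:~R - A%:~R * (n j.+1)%:~R * (b%:~R) ^+ (d' - d) =
     A%:~R * b%:R ^+ (d' - d) * (q%:R * (map_poly intr ps`_j.+1).[a%:~R / b%:R] - (n j.+1)%:~R) :> R.
    have mER : q%:R * A%:~R = m%:~R * b%:R ^+ d :> R.
      by have := congr1 (intr : int -> R) mE; rewrite !rmorphM /= rmorphXn.
    have -> : N%:~R = b%:R ^+ (d' - d) * b%:R ^+ d * (map_poly intr ps`_j.+1).[a%:~R / b%:R] :> R.
      by rewrite -exprD subnK.
    have alg (m' A' n' P' X Y q' : R) : q' * A' = m' * Y ->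
        m' * (X * Y * P') - A' * n' * X = A' * X * (q' * P' - n').
      by rewrite (_ : m' * (X * Y * P') = (m' * Y) * (X * P')) => [<-|]; ring.
    exact: alg mER.
  rewrite !normrM ler_wpM2r // intr_norm ler_wpM2l // normrX ger0_norm //.
  rewrite -!natrX ler_nat.
  have bq_gap : (b ^ (d' - d) <= q ^ (d' - d))%N.
    by have [->//|gap0] := posnP (d' - d)%N; rewrite leq_exp2r // dvdn_leq.
  apply: (leq_trans bq_gap); apply: leq_pexp2l => //; exact: gap.
apply: (mulfI A0).
transitivity (m * N * b%:Z ^+ d).
  by rewrite mulrCA mulrA mE mulrAC.
by rewrite mN -!mulrA -exprD subnK.
Qed.

(** With [a = a' g] and [b = b' g], where [a'] and [b'] are coprime, the lcm is
    [b' a]; after division by [g^d], Gauss's lemma gives what is left to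
    divide. *)
Lemma dvdn_exp_lcm (d a b m : nat) : (0 < a)%N -> (0 < b)%N ->
  (a ^ d %| m)%N -> (b ^ d %| m)%N -> (lcmn a b ^ d %| m)%N.
Proof.
move=> a0 b0 /dvdnP[k ->] bm.
have g0 : (0 < gcdn a b)%N by rewrite gcdn_gt0 a0.
have ga := divnK (dvdn_gcdl a b); have gb := divnK (dvdn_gcdr a b).
set a' := (a %/ gcdn a b)%N in ga; set b' := (b %/ gcdn a b)%N in gb.
have ab' : coprime b' a'.
  by rewrite /coprime -(eqn_pmul2r g0) muln_gcdl ga gb mul1n gcdnC.
have -> : lcmn a b = (b' * a)%N by rewrite /lcmn mulnC -{1}gb mulnAC mulnK.
set g := gcdn a b in g0 ga gb.
rewrite expnMn dvdn_pmul2r ?expn_gt0 ?a0 //.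
move: bm; rewrite -{1}gb -{1}ga !expnMn mulnA dvdn_pmul2r ?expn_gt0 ?g0 //.
by rewrite Gauss_dvdl // coprimeXl // coprimeXr.
Qed.

Lemma dvdn_exp_biglcm (I : finType) (d m : nat) (b : I -> nat) :
  (forall i, 0 < b i)%N -> (forall i, b i ^ d %| m)%N ->
  (0 < \big[lcmn/1%N]_i b i)%N && ((\big[lcmn/1%N]_i b i) ^ d %| m)%N.
Proof.
move=> b0 bm; apply: (big_ind (fun Q => (0 < Q)%N && (Q ^ d %| m)%N)).
- by rewrite exp1n dvd1n.
- move=> x y /andP[x0 xm] /andP[y0 ym].
  by rewrite lcmn_gt0 x0 y0 dvdn_exp_lcm.
- by move=> i _; rewrite b0 bm.
Qed.

Lemma reduced_fraction (n : int) (q : nat) : (0 < q)%N ->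
  exists a b, [/\ (b %| q)%N, coprimez a b & n * b%:Z = a * q%:Z].
Proof.
move=> q0; set g := gcdn `|n| q.
have g0 : (0 < g)%N by rewrite gcdn_gt0 q0 orbT.
have [b qE] := dvdnP (dvdn_gcdr `|n| q).
have /dvdzP[a nE] : (g %| n)%Z by rewrite dvdzE /= dvdn_gcdl.
exists a, b; split.
- by rewrite qE dvdn_mulr.
- have [u [v uv]] := Bezoutz n q.
  apply/coprimezP; exists (u, v) => /=.
  have gz : g%:Z != 0 by rewrite eqz_nat -lt0n.
  apply: (mulIf gz); rewrite mul1r mulrDl -!mulrA -nE -PoszM -qE.
  exact: uv.
- by rewrite [in LHS]nE [in RHS]qE -/g PoszM mulrAC mulrA.
Qed.

(** * The parametrization of the manifold *)

Lemma poly_locally_lipschitz (R : realType) (p : {poly R}) (B : R) : 0 <= B ->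
  exists2 L, 0 < L & forall x y, `|x| <= B -> `|y| <= B ->
    `|p.[x] - p.[y]| <= L * `|x - y|.
Proof.
move=> B0.
suff [L [K [L0 K0 bnd]]] : exists L K, [/\ 0 < L, 0 < K & forall x y,
    `|x| <= B -> `|y| <= B -> `|p.[x]| <= K /\ `|p.[x] - p.[y]| <= L * `|x - y|].
  by exists L => // x y xB yB; have [] := bnd x y xB yB.
elim/poly_ind: p => [|p c [L [K [L0 K0 IH]]]].
  by exists 1, 1; split => // x y _ _; rewrite !horner0 subrr normr0 mul1r normr_ge0 ler01.
exists (L * B + K), (K * B + `|c| + 1); split.
- by rewrite ltr_wpDl // mulr_ge0 // ltW.
- by rewrite ltr_wpDl // addr_ge0 // mulr_ge0 // ltW.
move=> x y xB yB; have [pxK pxy] := IH x y xB yB.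
rewrite !hornerMXaddC; split.
  rewrite (le_trans (ler_normD _ _)) // -addrA lerD // ?ler_wpDr // normrM ler_pM //.
have -> : p.[x] * x + c - (p.[y] * y + c) = p.[x] * (x - y) + (p.[x] - p.[y]) * y.
  by ring.
apply: (le_trans (ler_normD _ _)); rewrite !normrM mulrDl addrC lerD //.
  by rewrite mulrAC ler_pM // mulr_ge0.
by rewrite ler_wpM2r.
Qed.

Lemma poly_family_locally_lipschitz (R : realType) (I : finType)
    (p : I -> {poly R}) (B : R) : 0 <= B ->
  exists2 L, 0 < L & forall i x y, `|x| <= B -> `|y| <= B ->
    `|(p i).[x] - (p i).[y]| <= L * `|x - y|.
Proof.
move=> B0.
have ex i : exists L : R, 0 < L /\ forall x y, `|x| <= B -> `|y| <= B ->
    `|(p i).[x] - (p i).[y]| <= L * `|x - y|.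
  by have [L L0 lip] := poly_locally_lipschitz (p i) B0; exists L.
have [L LP] := choice ex; have L0 i : 0 < L i by have [] := LP i.
exists (\sum_i L i + 1); first by rewrite ltr_wpDl // sumr_ge0 // => i _; exact: ltW.
move=> i x y xB yB; have [_ /(_ x y xB yB)/le_trans] := LP i; apply.
rewrite ler_wpM2r // (bigD1 i) //= -addrA lerDl addr_ge0 //.
by apply: sumr_ge0 => l _; exact: ltW.
Qed.

Section PolynomialPoints.
Context {R : realType} {s : nat} {sigma : 'I_s -> nat}.
Variable P : forall i : 'I_s, (sigma i).-tuple {poly int}.

Definition poly_point (x : 'rV[R]_s) : 'rV[R]_(\sum_(i < s) sigma i) :=
  \mxrow_(i < s) \row_(j < sigma i) (map_poly intr (P i)`_j).[x 0 i].

Lemma poly_pointE x l : poly_point x 0 l =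
  (map_poly intr (P (tagnat.sig1 l))`_(tagnat.sig2 l)).[x 0 (tagnat.sig1 l)].
Proof. by rewrite !mxE. Qed.

Lemma poly_point_Rank x i (j : 'I_(sigma i)) :
  poly_point x 0 (tagnat.Rank i j) = (map_poly intr (P i)`_j).[x 0 i].
Proof.
transitivity (submxrow (poly_point x) i 0 j); first by rewrite [RHS]mxE.
by rewrite /poly_point mxrowK mxE.
Qed.

Lemma proj_first_poly_point (sigma_gt0 : forall i, (0 < sigma i)%N) x :
  (forall i, (P i)`_0 = 'X) -> proj_first sigma_gt0 (poly_point x) = x.
Proof.
move=> P0; apply/rowP => i; rewrite /proj_first mxE /poly_point mxrowK mxE /=.
by rewrite P0 map_polyX hornerX.
Qed.

Lemma poly_point_entry_lipschitz (B : R) : 0 <= B ->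
  exists2 L : R, 0 < L & forall i (j : 'I_(sigma i)) x y, `|x| <= B -> `|y| <= B ->
    `|(map_poly intr (P i)`_j).[x] - (map_poly intr (P i)`_j).[y]| <= L * `|x - y|.
Proof.
move=> B0; pose p (u : {i : 'I_s & 'I_(sigma i)}) : {poly R} :=
  map_poly intr (P (tag u))`_(tagged u).
have [L L0 lip] := poly_family_locally_lipschitz p B0; exists L => // i j.
exact: (lip (Tagged (fun i => 'I_(sigma i)) j)).
Qed.

Lemma poly_point_locally_lipschitz : locally_lipschitz poly_point.
Proof.
move=> B; have [L L0 lip] := poly_point_entry_lipschitz (ler0n R B).
exists ((\sum_(i < s) sigma i)%:R * L + 1) => [|x y e e0 xB yB xye].
  by rewrite ltr_wpDl // mulr_ge0 // ltW.
apply: (@le_trans _ _ ((\sum_(i < s) sigma i)%:R * (L * e))).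
  apply: eucl_dist_le => [|l]; first by rewrite mulr_ge0 // ltW.
  rewrite !poly_pointE; apply: le_trans (lip _ _ _ _ (xB _) (yB _)) _.
  by rewrite ler_pM2l.
by rewrite mulrA ler_wpM2r // lerDl.
Qed.

End PolynomialPoints.

(** * Approximation on the manifold and of the parameters *)

Section Denominators.
Context {R : realType} {s : nat} {sigma : 'I_s -> nat}.
Variable P : forall i : 'I_s, (sigma i).-tuple {poly int}.
Hypothesis sigma_gt0 : forall i, (0 < sigma i)%N.
Hypothesis P_first : forall i, (P i)`_0 = 'X.
Hypothesis P_deg : forall i, sorted leq [seq degp p | p <- P i].

Lemma degp_nondecreasing i j l : (j <= l < sigma i)%N ->
  (degp (P i)`_j <= degp (P i)`_l)%N.
Proof.
move=> /andP[jl li].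
have := sorted_leq_nth leq_trans leqnn 0%N (P_deg i); rewrite /prop_in2.
move=> /(_ j l); rewrite !inE size_map size_tuple => /(_ (leq_ltn_trans jl li) li jl).
by rewrite !(nth_map 0) ?size_tuple // (leq_ltn_trans jl li).
Qed.

Lemma degp_gt0 i j : (j < sigma i)%N -> (0 < degp (P i)`_j)%N.
Proof.
move=> ji; have := @degp_nondecreasing i 0%N j; rewrite ji P_first /degp size_polyX.
by apply.
Qed.

Lemma lead_prod_neq0 i j : (j <= sigma i)%N -> lead_prod (P i) j != 0.
Proof.
move=> ji; apply/prodf_neq0 => l _; rewrite expf_neq0 //.
have := degp_gt0 (leq_trans (ltn_ord l) ji); rewrite lead_coef_eq0.
by apply: contraTneq => ->; rewrite /degp size_poly0.
Qed.

Lemma min_last_deg_le i : (min_last_deg P <= last_deg P i)%N.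
Proof.
rewrite /min_last_deg; have := mem_index_enum i.
elim: (index_enum _) => //= j r IH; rewrite inE big_cons => /predU1P[<-|ir].
  exact: geq_minl.
by rewrite geq_min (IH ir) orbT.
Qed.

Lemma max_last_deg_ge i : (last_deg P i <= max_last_deg P)%N.
Proof. by rewrite /max_last_deg (bigD1 i) //= leq_maxl. Qed.

Lemma gap_le_max_gap i j : (j.+1 < sigma i)%N ->
  (degp (P i)`_j.+1 - degp (P i)`_j <= max_gap P)%N.
Proof.
move=> ji; have ji' : (j < (sigma i).-1)%N by rewrite -ltnS prednK.
apply: (@leq_trans (gap P i)); last by rewrite /max_gap (bigD1 i) //= leq_maxl.
by rewrite /gap (bigD1 (Ordinal ji')) //= leq_maxl.
Qed.

Lemma min_last_deg_gt0 : (0 < s)%N -> (0 < min_last_deg P)%N.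
Proof.
move=> s0; have last0 i : (0 < last_deg P i)%N by apply: degp_gt0; rewrite ltn_predL.
rewrite /min_last_deg; apply: (big_ind (fun d => 0 < d)%N) => //.
  exact: leq_trans (last0 (Ordinal s0)) (max_last_deg_ge _).
by move=> x y x0 y0; rewrite leq_min x0.
Qed.

(** One constant for all blocks: [Q^d] divides [q * lead_const]. *)
Definition lead_const : nat := `|(\prod_i lead_prod (P i) (sigma i))%R|%N.

Lemma lead_const_gt0 : (0 < lead_const)%N.
Proof.
rewrite absz_gt0; apply/prodf_neq0 => i _; exact: lead_prod_neq0.
Qed.

(** Each block has its own reduced denominator [b i] of the fraction close to
    [y i], and [block_denominator] makes [b i ^ d] divide [q * lead_const].
    Their lcm [Q] is a denominator for all the fractions at once, and its
    [d]-th power still divides. *)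
Lemma common_denominator (lambda : R) (y : 'rV[R]_s) :
  (max_gap P)%:R < lambda -> approx_set lambda (poly_point P y) ->
  forall eps : R, 0 < eps < lambda - (max_gap P)%:R -> forall N : nat,
  exists q Q : nat, [/\ (N < q)%N, (0 < Q)%N, (Q ^ min_last_deg P %| q * lead_const)%N &
    exists p : 'I_s -> int,
      forall i, `|Q%:R * y 0 i - (p i)%:~R| <= Q%:R * q%:R `^ (- lambda + eps - 1)].
Proof.
move=> gap_lambda /approx_setP appr eps /andP[eps0 eps_lt] N.
set t := max_gap P in gap_lambda eps_lt.
pose B := \sum_i `|y 0 i| + 1.
have B0 : 0 <= B by rewrite addr_ge0 // sumr_ge0.
have yB i : `|y 0 i| + 1 <= B by rewrite lerD2r (bigD1 i) //= lerDl sumr_ge0.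
have [L L0 lip] := poly_point_entry_lipschitz P B0.
(* An error delta on the values at y gives an error (L + 1) * delta at a/b;
   K bounds that factor times the constants of block_denominator. *)
pose K : R := \sum_i \sum_(j < sigma i) `|lead_prod (P i) j|%:~R * (L + 1).
have KP i (j : 'I_(sigma i)) : `|lead_prod (P i) j|%:~R * (L + 1) <= K.
  have ge0 i' j' : 0 <= `|lead_prod (P i') j'|%:~R * (L + 1).
    by rewrite mulr_ge0 ?ler0z // addr_ge0 // ltW.
  rewrite /K (bigD1 i) //= (bigD1 j) //= -addrA lerDl addr_ge0 // ?sumr_ge0 // => i' _.
  by rewrite sumr_ge0.
have x0 : 0 < lambda - eps - t%:R by lra.
have [N' N'P] := powR_eventually_gt K x0.
have [q Nq [n close]] := appr eps eps0 (maxn N N').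
have {Nq} [Nq N'q] : (N < q)%N /\ (N' < q)%N by apply/andP; rewrite -gtn_max.
have q0 : (0 < q)%N by exact: leq_ltn_trans Nq.
have qR0 : 0 < q%:R :> R by rewrite ltr0n.
have qR1 : 1 <= q%:R :> R by rewrite ler1n.
set delta := q%:R `^ (- lambda + eps) in close.
have delta0 : 0 <= delta by exact: powR_ge0.
have delta1 : delta <= 1 by rewrite -[leRHS](powRr0 q%:R) ler_powR //; have := ler0n R t; lra.
have Kdelta : K * q%:R ^+ t * delta < 1.
  rewrite -powR_mulrn // -mulrA -powR_addr //.
  have -> : t%:R + (- lambda + eps) = - (lambda - eps - t%:R) :> R by ring.
  by rewrite powRN ltr_pdivrMr ?powR_gt0 // mul1r N'P.
have closeE i (j : 'I_(sigma i)) :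
    `|q%:R * (map_poly intr (P i)`_j).[y 0 i] - (n (tagnat.Rank i j))%:~R| <= delta.
  by rewrite -poly_point_Rank.
pose n0 i := n (tagnat.Rank i (Ordinal (sigma_gt0 i))).
have ex i : exists ab : int * nat, [/\ (ab.2 %| q)%N, coprimez ab.1 ab.2 & n0 i * ab.2%:Z = ab.1 * q%:Z].
  by have [a [b abP]] := reduced_fraction (n0 i) q0; exists (a, b).
have [ab abP] := choice ex.
pose a i := (ab i).1; pose b i := (ab i).2.
have b0 i : (0 < b i)%N by have [bq _ _] := abP i; exact: dvdn_gt0 bq.
have abE i : (a i)%:~R / (b i)%:R = (n0 i)%:~R / q%:R :> R.
  have [_ _ /(congr1 (intr : int -> R))] := abP i.
  rewrite !rmorphM /= -/(a i) -/(b i) => e; apply/eqP.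
  by rewrite eqr_div ?pnatr_eq0 -?lt0n // -[q%:R]/(q%:~R) -e.
have y_ab i : `|y 0 i - (a i)%:~R / (b i)%:R| <= delta / q%:R.
  have := closeE i (Ordinal (sigma_gt0 i)); rewrite /= P_first map_polyX hornerX abE.
  rewrite -/(n0 i) => cl; rewrite ler_pdivlMr // -[X in _ * X]ger0_norm // -normrM.
  by rewrite mulrBl divfK ?gt_eqF // mulrC.
have abB i : `|(a i)%:~R / (b i)%:R| <= B.
  rewrite -[X in `|X|](subKr (y 0 i)) (le_trans (ler_normB _ _)) //.
  rewrite (le_trans _ (yB i)) // lerD2l (le_trans (y_ab i)) //.
  by rewrite ler_pdivrMr // mul1r (le_trans delta1).
have bq i : ((b i) ^ min_last_deg P %| q * lead_const)%N.
  have [b_q ab_coprime _] := abP i.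
  have := @block_denominator R (P i) t q (b i) (a i)
    (fun j => if insub j is Some j' then n (tagnat.Rank i j') else 0) (P_first i) (P_deg i).
  rewrite size_tuple => /(_ (@gap_le_max_gap i) q0 b_q ab_coprime).
  have last_lt : ((sigma i).-1 < sigma i)%N by rewrite ltn_predL.
  move=> /(_ _ _ last_lt); rewrite prednK // => blockP.
  apply: (@dvdn_trans (b i ^ last_deg P i)); first by rewrite dvdn_exp2l // min_last_deg_le.
  have -> : (b i ^ last_deg P i %| q * lead_const)%N =
     ((b i)%:Z ^+ last_deg P i %| q%:Z * \prod_i lead_prod (P i) (sigma i))%Z.
    by rewrite dvdzE /= abszX abszM.
  apply: (dvdz_trans (blockP _)); last by rewrite (bigD1 i) //= mulrA dvdz_mulr.
  move=> j ji; rewrite insubT /=.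
  set j' := Ordinal ji.
  have yB' : `|y 0 i| <= B by rewrite (le_trans _ (yB i)) // lerDl.
  have lip_j := lip i j' _ _ yB' (abB i); have close_j := closeE i j'.
  have KPj := KP i j'.
  move: lip_j close_j KPj => /=.
  set p := map_poly _ _; set r := _ / _ in abB *; set nj := n _.
  move=> lip_j close_j KPj.
  have bound : `|q%:R * p.[r] - nj%:~R| <= (L + 1) * delta.
    have split_error (u v w z : R) : u * v - w = (u * z - w) - u * (z - v) by ring.
    rewrite (split_error _ _ _ p.[y 0 i]) (le_trans (ler_normB _ _)) // mulrDl mul1r addrC lerD //.
    rewrite normrM ger0_norm // mulrC -ler_pdivlMr // (le_trans lip_j) //.
    by rewrite -mulrA ler_pM2l // y_ab.
  apply: le_lt_trans Kdelta; rewrite mulrAC [leRHS]mulrAC ler_wpM2r ?exprn_ge0 //.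
  rewrite (le_trans (ler_wpM2l _ bound)) ?ler0z // mulrA ler_wpM2r //.
have /andP[Q0 Qq] := dvdn_exp_biglcm b0 bq.
set Q := \big[lcmn/1%N]_i b i in Q0 Qq.
exists q, Q; split => //; exists (fun i => a i * (Q %/ b i)%N%:Z) => i.
have bQ : (b i %| Q)%N by exact: (biglcmn_sup i).
have QE : Q%:R = (Q %/ b i)%N%:R * (b i)%:R :> R by rewrite -natrM divnK.
have -> : (a i * (Q %/ b i)%N%:Z)%:~R = Q%:R * ((a i)%:~R / (b i)%:R) :> R.
  rewrite rmorphM /= -[((Q %/ b i)%N%:Z)%:~R]/((Q %/ b i)%N%:R) QE.
  by rewrite -[in RHS]mulrA [in RHS](mulrC (b i)%:R) divfK ?pnatr_eq0 -?lt0n // mulrC.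
rewrite -mulrBr normrM ger0_norm // ler_wpM2l // (le_trans (y_ab i)) //.
by rewrite powR_addr // -/delta powR_inv1.
Qed.

End Denominators.

Lemma approx_set_rational (R : realType) (m : nat) (mu : R) (y : 'rV[R]_m) (W : nat) :
  (0 < W)%N -> (forall i, exists z : int, W%:R * y 0 i = z%:~R) -> approx_set mu y.
Proof.
move=> W0 /choice[z zP]; apply/approx_setP => eps eps0 N; exists (N.+1 * W)%N.
  by rewrite leq_pmulr.
exists (fun i => z i *+ N.+1) => i.
by rewrite natrM -mulrA zP mulr_natl rmorphMn /= subrr normr0 powR_ge0.
Qed.

(** [common_denominator] provides [Q] with the right exponent, as
    [Q^d <= q * lead_const].  These [Q]'s may stay bounded while [q] grows: then
    [y] is approximated arbitrarily well with a bounded denominator, so it is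
    rational, and a rational point has every exponent. *)
Lemma approx_set_poly_point_sub (R : realType) (s : nat) (sigma : 'I_s -> nat)
    (P : forall i : 'I_s, (sigma i).-tuple {poly int}) (lambda : R) (y : 'rV[R]_s) :
  (0 < s)%N -> (forall i, (0 < sigma i)%N) -> (forall i, (P i)`_0 = 'X) ->
  (forall i, sorted leq [seq degp p | p <- P i]) ->
  (max_gap P)%:R < lambda -> approx_set lambda (poly_point P y) ->
  approx_set ((min_last_deg P)%:R * lambda + (min_last_deg P)%:R - 1) y.
Proof.
move=> s0 sigma_gt0 P_first P_deg gap_lambda appr.
have [[W [W0 WP]]|nW] := pselect (exists W, (0 < W)%N /\
    forall i, exists z : int, W%:R * y 0 i = z%:~R).
  exact: approx_set_rational W0 WP.
apply/approx_setP => eps' eps'0 N.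
have d0 : (0 < min_last_deg P)%N by exact: min_last_deg_gt0.
have A0 := lead_const_gt0 P_first P_deg.
have common := common_denominator sigma_gt0 P_first P_deg gap_lambda appr.
move: d0 A0 common; set d := min_last_deg P; set A := lead_const P.
move=> d0 A0 common; have dR0 : 0 < d%:R :> R by rewrite ltr0n.
have t0 : 0 <= (max_gap P)%:R :> R by [].
move: (max_gap P)%:R t0 gap_lambda common => t t0 gap_lambda common.
have [eps [eps0 eps_gap eps_d]] : exists eps, [/\ 0 < eps, eps < lambda - t & d%:R * eps <= eps' / 2].
  have gap0 : 0 < (lambda - t) / 2 by lra.
  have d'0 : 0 < eps' / 2 / d%:R by rewrite !divr_gt0.
  exists (Num.min ((lambda - t) / 2) (eps' / 2 / d%:R)); split.
  - by rewrite lt_min gap0.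
  - by rewrite gt_min; apply/orP; left; lra.
  - by rewrite mulrC -ler_pdivlMr // ge_min lexx orbT.
pose x := lambda + 1 - eps.
have x1 : 1 < x by rewrite /x; lra.
have eps'2 : 0 < eps' / 2 by lra.
have [N' N'P] := powR_eventually_gt (A%:R `^ x) eps'2.
(* W is a common multiple of all the denominators up to N1. *)
pose N1 := maxn N N'; pose W := N1`!.
have W0 : (0 < W)%N by exact: fact_gt0.
have [i ni] : exists i, forall z : int, W%:R * y 0 i != z%:~R.
  apply: contrapT => all_int; apply: nW; exists W; split => // i.
  apply: contrapT => ni; apply: all_int; exists i => z; apply/eqP => Wz.
  by apply: ni; exists z.
have dist0 : 0 < dist_int (W%:R * y 0 i).
  have [z zle _] := dist_int_attained (W%:R * y 0 i).
  by apply: lt_le_trans zle; rewrite normr_gt0 subr_eq0.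
have eps_ok : 0 < eps < lambda - t by rewrite eps0.
have [q [Q [Nq Q0 Qq [p close]]]] :=
  common eps eps_ok (Num.trunc (W%:R / dist_int (W%:R * y 0 i))).+1.
have q0 : (0 < q)%N by exact: leq_ltn_trans Nq.
have qR0 : 0 < q%:R :> R by rewrite ltr0n.
have xE : - lambda + eps - 1 = - x by rewrite /x; ring.
rewrite xE in close.
have QR1 : 1 <= Q%:R :> R by rewrite ler1n.
have QR0 : 0 < Q%:R :> R by rewrite ltr0n.
have N1Q : (N1 < Q)%N.
  rewrite ltnNge; apply/negP => QN1.
  have /dvdnP[k Wk] : (Q %| W)%N by rewrite dvdn_fact // Q0.
  have := dist_int_le (W%:R * y 0 i) (k%:Z * p i); apply/negP; rewrite -ltNge.
  have -> : W%:R * y 0 i - (k%:Z * p i)%:~R = k%:R * (Q%:R * y 0 i - (p i)%:~R).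
    by rewrite rmorphM /= Wk natrM mulrBr mulrA.
  rewrite normrM ger0_norm // (le_lt_trans (ler_wpM2l _ (close i))) //.
  rewrite mulrA -natrM -Wk.
  apply: (@le_lt_trans _ _ (W%:R / q%:R)).
    rewrite ler_wpM2l // -powR_inv1 // ler_powR ?ler1n //; lra.
  rewrite ltr_pdivrMr // mulrC -ltr_pdivrMr // (lt_trans (truncnS_gt _)) //.
  by rewrite ltr_nat.
exists Q; first by rewrite (leq_ltn_trans (leq_maxl _ _) N1Q).
exists p => j; apply: (le_trans (close j)).
have C_lt : A%:R `^ x < Q%:R `^ (eps' / 2).
  by apply: N'P; rewrite (leq_ltn_trans (leq_maxr _ _) N1Q).
have Qq' : Q%:R `^ (d%:R * x) <= q%:R `^ x * A%:R `^ x.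
  rewrite -powRM // powRrM powR_mulrn // -natrX -natrM.
  rewrite ge0_ler_powR ?nnegrE ?ler_nat //; first by lra.
  by rewrite dvdn_leq // muln_gt0 q0.
apply: (@le_trans _ _ (Q%:R * (Q%:R `^ (- (d%:R * x)) * Q%:R `^ (eps' / 2)))).
  rewrite ler_pM2l // !powRN ler_pdivlMl ?powR_gt0 // ler_pdivrMr ?powR_gt0 //.
  apply: (le_trans Qq'); rewrite mulrC ler_pM2r ?powR_gt0 //; exact: ltW.
rewrite -[X in X * _]powRr1 // -!powR_addr // ler_powR // /x.
have -> : 1 + (- (d%:R * (lambda + 1 - eps)) + eps' / 2) =
   - (d%:R * lambda + d%:R - 1) + d%:R * eps + eps' / 2 by ring.
lra.
Qed.
(** If [Q] approximates [y] then [Q^d] approximates each [P(y)], because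
    [Q^d P(p/Q)] is an integer when [deg P <= d], and [P] is Lipschitz. *)
Lemma approx_set_poly_point_sup (R : realType) (s : nat) (sigma : 'I_s -> nat)
    (P : forall i : 'I_s, (sigma i).-tuple {poly int}) (d : nat) (lambda : R) (y : 'rV[R]_s) :
  (0 < d)%N -> (forall i (j : 'I_(sigma i)), (degp (P i)`_j <= d)%N) -> 0 < lambda ->
  approx_set (d%:R * lambda + d%:R - 1) y -> approx_set lambda (poly_point P y).
Proof.
move=> d0 degd lambda0 /approx_setP appr; apply/approx_setP => eps' eps'0 N.
have dR0 : 0 < d%:R :> R by rewrite ltr0n.
have dR1 : 1 <= d%:R :> R by rewrite ler1n.
set mu := _ - 1 in appr.
have mu0 : 0 < mu by rewrite /mu; have := mulr_gt0 dR0 lambda0; lra.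
pose B := \sum_i `|y 0 i| + 1.
have B0 : 0 <= B by rewrite addr_ge0 // sumr_ge0.
have yB i : `|y 0 i| + 1 <= B by rewrite lerD2r (bigD1 i) //= lerDl sumr_ge0.
have [L L0 lip] := poly_point_entry_lipschitz P B0.
have deps0 : 0 < d%:R * eps' / 2 by rewrite !mulr_gt0 // invr_gt0.
have [eps [eps0 eps_mu eps_d]] :
    exists eps, [/\ 0 < eps, eps <= mu & eps <= d%:R * eps' / 2].
  exists (Num.min mu (d%:R * eps' / 2)); split.
  - by rewrite lt_min mu0.
  - by rewrite ge_min lexx.
  - by rewrite ge_min lexx orbT.
have [N' N'P] := powR_eventually_gt L deps0.
have [q Nq [p close]] := appr eps eps0 (maxn N N').
have {Nq} [Nq N'q] : (N < q)%N /\ (N' < q)%N by apply/andP; rewrite -gtn_max.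
have q0 : (0 < q)%N by exact: leq_ltn_trans Nq.
have qR0 : 0 < q%:R :> R by rewrite ltr0n.
have qR1 : 1 <= q%:R :> R by rewrite ler1n.
exists (q ^ d)%N; first by rewrite (leq_trans Nq) // -{1}(expn1 q) leq_pexp2l.
have ex (l : 'I_(\sum_(i < s) sigma i)) : exists n : int, (q ^ d)%:R *
    (map_poly intr (P (tagnat.sig1 l))`_(tagnat.sig2 l)).[(p (tagnat.sig1 l))%:~R / q%:R] = n%:~R :> R.
  set i := tagnat.sig1 l; set j := tagnat.sig2 l.
  have [n nE _] := poly_rational_value R (P i)`_j (p i) q0.
  exists (q%:Z ^+ (d - degp (P i)`_j) * n).
  have dj : (degp (P i)`_j <= d)%N by exact: degd.
  by rewrite rmorphM rmorphXn /= -nE mulrA -exprD subnK ?natrX.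
have [n nE] := choice ex; exists n => l; rewrite -nE poly_pointE.
set i := tagnat.sig1 l; set j := tagnat.sig2 l.
have y_pq : `|y 0 i - (p i)%:~R / q%:R| <= q%:R `^ (- mu + eps - 1).
  rewrite powR_addr // powR_inv1 // ler_pdivlMr // -[X in _ * X]ger0_norm // -normrM.
  by rewrite mulrBl divfK ?gt_eqF // [y 0 i * _]mulrC.
have pqB : `|(p i)%:~R / q%:R| <= B.
  rewrite -[X in `|X|](subKr (y 0 i)) (le_trans (ler_normB _ _)) //.
  rewrite (le_trans _ (yB i)) // lerD2l (le_trans y_pq) //.
  by rewrite -[leRHS](powRr0 q%:R) ler_powR //; lra.
have yB' : `|y 0 i| <= B by rewrite (le_trans _ (yB i)) // lerDl.
rewrite -mulrBr normrM ger0_norm //.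
apply: (@le_trans _ _ (q%:R `^ d%:R * (q%:R `^ (d%:R * eps' / 2) * q%:R `^ (- mu + eps - 1)))).
  rewrite natrX powR_mulrn // ler_wpM2l ?exprn_ge0 //.
  apply: (le_trans (lip i j _ _ yB' pqB)); apply: ler_pM => //; first exact: ltW.
  exact/ltW/N'P.
rewrite natrX -powR_mulrn // -powRrM -!powR_addr // ler_powR // /mu.
have -> : d%:R + (d%:R * eps' / 2 + (- (d%:R * lambda + d%:R - 1) + eps - 1)) =
  d%:R * (- lambda + eps') + (eps - d%:R * eps' / 2) by field.
by rewrite gerDl subr_le0.
Qed.

(** * Counting cells that contain rational points *)

(** Pigeonhole: among the [n^s + 1] vectors of fractional parts of
    [k y], two lie in the same of the [n^s] boxes of side [1/n]. *)
Lemma simultaneous_dirichlet (R : realType) (s n : nat) (y : 'I_s -> R) : (0 < n)%N ->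
  exists2 q : nat, (0 < q <= n ^ s)%N &
    exists p : 'I_s -> int, forall j, `|q%:R * y j - (p j)%:~R| <= n%:R^-1.
Proof.
move=> n0; have nR0 : 0 < n%:R :> R by rewrite ltr0n.
pose frac x : R := x - (Num.floor x)%:~R.
have frac_itv x : 0 <= frac x < 1.
  by have /andP[] := floor_itv x; rewrite intrD /= /frac => ? ?; apply/andP; split; lra.
have box_lt x : (Num.trunc (n%:R * frac x) < n)%N.
  have /andP[x0 x1] := frac_itv x.
  rewrite truncn_lt_nat ?mulr_ge0 ?ler0n //.
  by rewrite -[ltRHS]mulr1 ltr_pM2l.
pose box (k : 'I_(n ^ s).+1) : {ffun 'I_s -> 'I_n} := [ffun j => Ordinal (box_lt (k%:R * y j))].
have /injectivePn[k [k' kk' box_eq]] : ~~ injectiveb box.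
  apply/negP => /injectiveP /leq_card; rewrite card_ffun !card_ord => /leq_trans/(_ (leqnn _)).
  by rewrite ltnn.
wlog lt_kk' : k k' kk' box_eq / (k < k')%N.
  move=> wl; have [lt|gt|/val_inj eq] := ltngtP k k'.
  - exact: (wl k k').
  - by apply: (wl k' k) => //; rewrite eq_sym.
  - by rewrite eq eqxx in kk'.
exists (k' - k)%N.
  rewrite subn_gt0 lt_kk' /=; rewrite (leq_trans (leq_subr _ _)) //.
  by rewrite -ltnS ltn_ord.
exists (fun j => Num.floor (k'%:R * y j) - Num.floor (k%:R * y j)) => j.
have := congr1 (fun f : {ffun 'I_s -> 'I_n} => val (f j)) box_eq; rewrite !ffunE /= => same_box.
rewrite (natrB _ (ltnW lt_kk')) intrB mulrBl.
set x := k%:R * y j in same_box *; set x' := k'%:R * y j in same_box *.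
have -> : x' - x - ((Num.floor x')%:~R - (Num.floor x)%:~R) = frac x' - frac x.
  rewrite /frac; lra.
have tr z : (Num.trunc (n%:R * frac z))%:R <= n%:R * frac z < (Num.trunc (n%:R * frac z))%:R + 1.
  rewrite natr1 truncn_itv // mulr_ge0 ?ler0n //.
  by have /andP[] := frac_itv z.
rewrite -[leRHS]mul1r ler_pdivlMr // -[X in _ * X]ger0_norm // -normrM mulrC mulrBr.
have /andP[] := tr x; have /andP[] := tr x'; rewrite -same_box ler_norml; lra.
Qed.
(** Used to inject a set of indices that has diameter at most [D] into [D.+1]
    values, with no need to locate its minimum. *)
Lemma modn_inj_close (D i j : nat) : (i <= j + D)%N -> (j <= i + D)%N ->
  i = j %[mod D.+1] -> i = j.
Proof.
wlog lij : i j / (i <= j)%N.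
  by move=> wl; have [|/ltnW] := leqP i j => lij ? ? e; [|symmetry]; apply: wl.
move=> _ ji /eqP; rewrite eq_sym eqn_mod_dvd // => Dij.
apply/eqP; rewrite eqn_leq lij /= -subn_eq0 eqn0Ngt; apply/negP => ij0.
by have := dvdn_leq ij0 Dij; rewrite ltnNge leq_subLR ji.
Qed.

Definition nearest (R : realType) (x : R) : int := Num.floor (x + 2^-1).

Lemma nearest_bound (R : realType) (x : R) : `|x - (nearest x)%:~R| <= 2^-1.
Proof.
have /andP[] := floor_itv (x + 2^-1); rewrite -/(nearest x) intrD /= => l u.
rewrite ler_norml; apply/andP; split; lra.
Qed.

Lemma nearest_unique (R : realType) (x : R) (p : int) : `|x - p%:~R| < 2^-1 -> nearest x = p.
Proof.
rewrite ltr_norml => /andP[l u]; apply: floor_def; rewrite intrD /=; apply/andP; split; lra.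
Qed.

(** The progression spans a length [M beta], hence meets at most
    [M beta + 2] integers; the indices whose terms are within [w] of the same
    integer differ by at most [2 w / beta]. *)
Lemma card_near_int_progression (R : realType) (alpha beta w : R) (M : nat) :
  0 < beta -> 0 <= w ->
  #|[pred i : 'I_M | `|alpha + i%:R * beta - (nearest (alpha + i%:R * beta))%:~R| <= w]|%:R
    <= (M%:R * beta + 2) * (2 * w / beta + 1).
Proof.
move=> beta0 w0; set x := fun i : 'I_M => alpha + i%:R * beta.
pose K := Num.trunc (M%:R * beta + 1); pose D := Num.trunc (2 * w / beta).
have Mb0 : 0 <= M%:R * beta by rewrite mulr_ge0 // ltW.
have wb0 : 0 <= 2 * w / beta by rewrite divr_ge0 ?mulr_ge0 // ltW.
have ib i : 0 <= (i : 'I_M)%:R * beta <= M%:R * beta.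
  by rewrite mulr_ge0 ?(ltW beta0) //= ler_pM2r // ler_nat ltnW.
have p_ge i : nearest alpha <= nearest (x i).
  by apply: le_floor; rewrite lerD2r lerDl; have /andP[] := ib i.
have col_lt i : (`|nearest (x i) - nearest alpha|%N < K.+1)%N.
  rewrite ltnS truncn_ge_nat ?addr_ge0 // natr_absz ger0_norm ?subr_ge0 // intrB.
  have := nearest_bound (x i); have := nearest_bound alpha; have := ib i.
  rewrite !ler_norml /x; lra.
pose f i : 'I_K.+1 * 'I_D.+1 := (Ordinal (col_lt i), inord (i %% D.+1)).
have f_inj : {in [pred i : 'I_M | `|x i - (nearest (x i))%:~R| <= w] &, injective f}.
  move=> i j; rewrite !inE => iw jw [same_col same_row].
  have pij : nearest (x i) = nearest (x j).
    apply: (addIr (- nearest alpha)).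
    by rewrite -[LHS]gez0_abs ?subr_ge0 // -[RHS]gez0_abs ?subr_ge0 // same_col.
  have {}same_row : i = j %[mod D.+1].
    by have := congr1 val same_row; rewrite /= !inordK // ltn_mod.
  have close (k l : 'I_M) : `|x k - (nearest (x j))%:~R| <= w ->
      `|x l - (nearest (x j))%:~R| <= w -> (k <= l + D)%N.
    move=> kw lw; have : k%:R - l%:R <= 2 * w / beta.
      rewrite ler_pdivlMr // mulrBl; move: kw lw; rewrite /x !ler_norml; lra.
    have [kl _|lk] := leqP k l; first by rewrite (leq_trans kl) ?leq_addr.
    by rewrite -(natrB _ (ltnW lk)) -leq_subLR truncn_ge_nat.
  rewrite pij in iw.
  by apply/val_inj/(modn_inj_close (close _ _ iw jw) (close _ _ jw iw)).
rewrite -(card_in_image f_inj).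
apply: (@le_trans _ _ (K.+1 * D.+1)%:R).
  by rewrite ler_nat (leq_trans (max_card _)) // card_prod !card_ord.
rewrite natrM ler_pM // -natr1.
  have := truncn_le (M%:R * beta + 1); rewrite -/K addr_ge0 //; lra.
by rewrite lerD2r truncn_le.
Qed.
(** A cube with corner [b] is cut in [M^s] cells of side [h], indexed by
    [c]. *)
Definition cell_center (R : realType) (s M : nat) (b : 'I_s -> R) (h : R)
  (c : {ffun 'I_s -> 'I_M}) (j : 'I_s) : R := b j + ((c j)%:R + 2^-1) * h.

(** The rational point [p/q] is at distance at most [1/(n q)] from the centre,
    and by the lower bound on [q] this is at most [K / n^(s+1)]. *)
Definition good_cell (R : realType) (s M K n : nat) (b : 'I_s -> R) (h : R)
  (c : {ffun 'I_s -> 'I_M}) : Prop :=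
  exists q (p : 'I_s -> int), [/\ (n ^ s < q * K)%N, (q <= n ^ s)%N &
    forall j, `|q%:R * cell_center b h c j - (p j)%:~R| <= n%:R^-1].

Lemma card_family_le (R : realType) (s M : nat) (F : 'I_s -> pred 'I_M) (T : R) :
  (forall j, #|F j|%:R <= T) -> #|family F|%:R <= T ^+ s.
Proof.
move=> FT; rewrite card_family foldrE big_map natr_prod.
have -> : T ^+ s = \prod_(j <- enum 'I_s) T.
  by rewrite big_enum prodr_const card_ord.
apply: ler_prod => j _; rewrite FT andbT //.
Qed.

Lemma card_exists_le (T I : finType) (A : I -> pred T) :
  (#|[pred c | [exists i, c \in A i]]| <= \sum_i #|A i|)%N.
Proof.
rewrite -sum1_card.
under [leqRHS]eq_bigr do rewrite -sum1_card big_mkcond.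
rewrite exchange_big [leqLHS]big_mkcond; apply: leq_sum => c _ /=.
rewrite inE; case: existsP => // -[i ci].
by rewrite (bigD1 i) //= ci.
Qed.

Lemma sum_ltn_indicator (m k : nat) : (\sum_(i < m) (i < k) = minn m k)%N.
Proof.
elim: m => [|m IH]; first by rewrite big_ord0 min0n.
rewrite big_ord_recr /= IH; case: (ltnP m k) => mk.
  by rewrite (minn_idPl mk) addn1.
by rewrite (minn_idPr (leqW mk)) addn0.
Qed.

(** By Dirichlet's theorem each centre has an approximation of denominator
    [q <= n^s], so a cell is good unless [q <= n^s / K].  For such a [q], the
    coordinates of the centres near a multiple of [1/q] are counted by
    [card_near_int_progression]: their proportion is at most
    [10/n * (1 + 2/(q r))], whose [s]-th power is about [(10/n)^s] unless [q] is
    small compared with [1/r].  Summed over [q <= n^s / K], this is at most half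
    of the cells: a quarter from [20^s / K] and a quarter from the finitely many
    small [q], for large [n].  The number [M] of cells per side makes
    [h] lie between [4 K / n^(s+1)] and [8 K / n^(s+1)]. *)
Lemma many_good_cells (R : realType) (s : nat) (r : R) : (0 < s)%N -> 0 < r <= 1 ->
  let K := (4 * 20 ^ s)%N in
  exists n0, forall n, (n0 <= n)%N ->
    let M := Num.trunc (r * n%:R ^+ s.+1 / (4 * K)%:R) in
    (0 < M)%N /\ forall b : 'I_s -> R,
      (M ^ s <= 2 * #|[pred c : {ffun 'I_s -> 'I_M} | `[< good_cell K n b (r / M%:R) c >]]|)%N.
Proof.
move=> s0 /andP[r0 r1] K.
have K0 : (0 < K)%N by rewrite muln_gt0 expn_gt0.
have KR0 : 0 < K%:R :> R by rewrite ltr0n.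
(* Beyond q0 the factor 1 + 2/(q r) is at most 2; C bounds the contribution of
   the smaller q. *)
pose q0 := (Num.trunc (2 / r)).+1.
have q0P : 2 / r < q0%:R by exact: truncnS_gt.
have r2 : 0 < 2 / r by rewrite divr_gt0.
pose C := 4 * 10 ^+ s * q0%:R * (1 + 2 / r) ^+ s.
exists (Num.trunc C + Num.trunc (4 * K%:R / r)).+1 => n n_large.
have Cn : C <= n%:R.
  apply: (le_trans (ltW (truncnS_gt C))); rewrite ler_nat (leq_trans _ n_large) //.
  by rewrite ltnS leq_addr.
have Kn : 4 * K%:R / r <= n%:R.
  apply: (le_trans (ltW (truncnS_gt _))); rewrite ler_nat (leq_trans _ n_large) //.
  by rewrite ltnS leq_addl.
have n0 : (0 < n)%N by exact: leq_trans n_large.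
have nR0 : 0 < n%:R :> R by rewrite ltr0n.
have nR1 : 1 <= n%:R :> R by rewrite ler1n.
have n_le_ns : n%:R <= n%:R ^+ s :> R by rewrite ler_eXnr.
set X := r * n%:R ^+ s.+1 / (4 * K)%:R; move=> M.
have X1 : 1 <= X.
  rewrite /X natrM ler_pdivlMr ?mulr_gt0 // mul1r -ler_pdivrMl // mulrC.
  by rewrite (le_trans Kn) // ler_eXnr.
have M0 : (0 < M)%N by rewrite /M truncn_gt0.
have MR0 : 0 < M%:R :> R by rewrite ltr0n.
split=> // b; set h := r / M%:R.
have h0 : 0 < h by rewrite divr_gt0.
have Mh : M%:R * h = r by rewrite mulrC divfK ?gt_eqF.
have h_le : n%:R * (n%:R ^+ s * h) <= 8 * K%:R.
  rewrite mulrA -exprS /h mulrA ler_pdivrMr // mulrC.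
  have : X <= 2 * M%:R.
    have : X < M%:R + 1 by rewrite natr1 truncnS_gt.
    have : 1 <= M%:R :> R by rewrite ler1n.
    lra.
  rewrite /X natrM ler_pdivrMr ?mulr_gt0 //; lra.
pose m := (n ^ s %/ K)%N.
have mK : m%:R * K%:R <= n%:R ^+ s :> R by rewrite -natrM -natrX ler_nat leq_trunc_div.
pose near q j : pred 'I_M := [pred i : 'I_M |
   `|q%:R * (b j + h / 2) + i%:R * (q%:R * h) -
     (nearest (q%:R * (b j + h / 2) + i%:R * (q%:R * h)))%:~R| <= n%:R^-1].
pose bad : pred {ffun 'I_s -> 'I_M} := [pred c | [exists i : 'I_m, c \in family (near i.+1)]].
have C4 : 4 <= C.
  have ge1 (x : R) : 0 <= x -> 1 <= (1 + x) ^+ s by move=> x0; rewrite exprn_ege1 // lerDl.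
  have p10 : 1 <= 10 ^+ s :> R by rewrite exprn_ege1 // ler1n.
  have q01 : 1 <= q0%:R :> R by rewrite ler1n.
  rewrite /C -[leLHS]mulr1 -!mulrA ler_pM2l // mulr_ege1 // mulr_ege1 // ge1 //.
  exact: ltW.
(* C >= 4 forces 1/n < 1/2, so that the integer given by Dirichlet's theorem is
   the nearest one. *)
have n3 : n%:R^-1 < 2^-1 :> R by rewrite ltf_pV2 ?posrE //; lra.
have bad_or_good c : bad c || `[< good_cell K n b h c >].
  have [q /andP[q1 qn] [p pP]] := simultaneous_dirichlet (cell_center b h c) n0.
  have [qm|mq] := leqP q m.
    apply/orP; left; apply/existsP; have qm' : (q.-1 < m)%N by rewrite prednK.
    exists (Ordinal qm'); apply/familyP => j; rewrite inE /= prednK //.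
    have e : q%:R * (b j + h / 2) + (c j)%:R * (q%:R * h) = q%:R * cell_center b h c j.
      by rewrite /cell_center; ring.
    rewrite e (nearest_unique (p := p j)) //; apply: le_lt_trans n3; exact: pP.
  apply/orP; right; apply/asboolP; exists q, p; split=> //.
  by rewrite -ltn_divLR.
have card_near q j : (0 < q <= m)%N ->
    #|near q j|%:R <= 10 * M%:R / n%:R * (1 + 2 / (q%:R * r)).
  move=> /andP[q1 qm]; have qR0 : 0 < q%:R :> R by rewrite ltr0n.
  have qh0 : 0 < q%:R * h by rewrite mulr_gt0.
  have nV0 : 0 <= n%:R^-1 :> R by rewrite invr_ge0.
  apply: (le_trans (card_near_int_progression _ _ qh0 nV0)).
  have nqh8 : n%:R * q%:R * h <= 8.
    rewrite -(ler_pM2r KR0) (le_trans _ h_le) //.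
    have -> : n%:R * q%:R * h * K%:R = n%:R * (q%:R * K%:R * h) by ring.
    rewrite ler_pM2l // ler_pM2r // (le_trans _ mK) // ler_pM2r // ler_nat //.
  have nqh0 : 0 < n%:R * q%:R * h by rewrite mulr_gt0 // mulr_gt0.
  have -> : M%:R * (q%:R * h) + 2 = q%:R * r + 2 by rewrite mulrCA Mh.
  have -> : 10 * M%:R / n%:R * (1 + 2 / (q%:R * r)) = (q%:R * r + 2) * (10 / (n%:R * q%:R * h)).
    by rewrite -Mh; field; rewrite !gt_eqF.
  have qr2 : 0 <= q%:R * r + 2 by rewrite addr_ge0 // mulr_ge0 // ltW.
  apply: ler_wpM2l => //.
  have -> : 2 * n%:R^-1 / (q%:R * h) + 1 = (2 + n%:R * q%:R * h) / (n%:R * q%:R * h).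
    by field; rewrite !gt_eqF.
  rewrite ler_pM2r ?invr_gt0 //; lra.
have card_bad : #|bad|%:R <= M%:R ^+ s / 2 :> R.
  apply: (@le_trans _ _ (\sum_(i < m) (10 * M%:R / n%:R * (1 + 2 / (i.+1%:R * r))) ^+ s)).
    apply: (@le_trans _ _ (\sum_(i < m) #|family (near i.+1)|)%:R).
      by rewrite ler_nat; exact: card_exists_le.
    rewrite natr_sum; apply: ler_sum => i _; apply: card_family_le => j.
    by apply: card_near; rewrite /= ltn_ord.
  under eq_bigr do rewrite exprMn.
  rewrite -mulr_sumr.
  have sum_le : \sum_(i < m) (1 + 2 / (i.+1%:R * r)) ^+ s <=
      m%:R * 2 ^+ s + q0%:R * (1 + 2 / r) ^+ s.
    have -> : m%:R * 2 ^+ s = \sum_(i < m) 2 ^+ s :> R.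
      by rewrite sumr_const card_ord mulr_natl.
    have few : (\sum_(i < m) (i < q0) <= q0)%N.
      by rewrite sum_ltn_indicator geq_minr.
    have E0 : 0 <= (1 + 2 / r) ^+ s by rewrite exprn_ge0 // addr_ge0 // ltW.
    apply: (@le_trans _ _ (\sum_(i < m) 2 ^+ s + (\sum_(i < m) (i < q0))%N%:R * (1 + 2 / r) ^+ s)).
      rewrite natr_sum mulr_suml -big_split /=; apply: ler_sum => i _.
      have i0 : 0 < i.+1%:R :> R by rewrite ltr0n.
      have i1 : 1 <= i.+1%:R :> R by rewrite ler1n.
      have term : 2 / (i.+1%:R * r) = 2 / r / i.+1%:R by field; rewrite !gt_eqF.
      have term0 : 0 <= 2 / r / i.+1%:R by rewrite divr_ge0 // ltW.
      rewrite term; have [_|q0i] := ltnP i q0.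
        rewrite mul1r; apply: ler_wpDl; first by rewrite exprn_ge0.
        apply: lerXn2r; rewrite ?nnegrE ?addr_ge0 ?(ltW r2) //.
        by rewrite lerD2l ler_pdivrMr // ler_peMr // ltW.
      rewrite mul0r addr0; apply: lerXn2r; rewrite ?nnegrE ?addr_ge0 //.
      rewrite -[leRHS]/(1 + 1) lerD2l ler_pdivrMr // mul1r (le_trans (ltW q0P)) //.
      by rewrite ler_nat ltnW.
    by rewrite lerD2l ler_wpM2r // ler_nat.
  apply: (le_trans (ler_wpM2l _ sum_le)).
    by rewrite exprn_ge0 // !mulr_ge0 // invr_ge0.
  rewrite !exprMn exprVn; set a := 10 ^+ s; set E := (1 + 2 / r) ^+ s.
  have Z0 : 0 < n%:R ^+ s :> R by rewrite exprn_gt0.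
  have a20 : a * 2 ^+ s = 20 ^+ s by rewrite -exprMn -natrM.
  have small_q : a * (m%:R * 2 ^+ s) <= n%:R ^+ s / 4.
    move: mK; rewrite /K natrM natrX -a20 mulrCA; lra.
  have large_q : a * (q0%:R * E) <= n%:R ^+ s / 4.
    move: (le_trans Cn n_le_ns); rewrite /C -/a -/E -!mulrA; lra.
  rewrite -!mulrA mulrCA ler_wpM2l ?exprn_ge0 //.
  rewrite mulrCA ler_pdivrMl // mulrDr; lra.
have card_split : (M ^ s <= #|bad| + #|[pred c : {ffun 'I_s -> 'I_M} | `[< good_cell K n b h c >]]|)%N.
  have <- : #|{: {ffun 'I_s -> 'I_M}}| = (M ^ s)%N by rewrite card_ffun !card_ord.
  rewrite -cardUI; apply: leq_trans (leq_addr _ _); apply: subset_leq_card.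
  by apply/fintype.subsetP => c _; rewrite inE; exact: bad_or_good.
rewrite -(ler_nat R) natrM natrX.
move: card_split; rewrite -(ler_nat R) natrD natrX; lra.
Qed.

(** * Averaging the cost of a cover over a family of cubes *)

Section CubeLoad.
Context {R : realType} {s : nat}.
Implicit Types (b : 'I_s -> R) (U : set 'rV[R]_s) (r u a : R).

Definition cube b r : set 'rV[R]_s := [set x | forall j, b j <= x 0 j <= b j + r].

Definition small_width U u : Prop :=
  forall x y, U x -> U y -> forall j, `|x 0 j - y 0 j| <= u.

(** An upper bound for the share of the Cantor set inside the cube that a set
    [U] of width [u] can take up. *)
Definition load (D a : R) U u b r : R :=
  if `[< cube b r `&` U !=set0 >] then Num.min 1 (D * (u / r) `^ a) else 0.

Lemma load_ge0 D a U u b r : 0 <= D -> 0 <= load D a U u b r.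
Proof.
by move=> D0; rewrite /load; case: ifP => // _; rewrite le_min ler01 mulr_ge0 // powR_ge0.
Qed.

Lemma load_le1 D a U u b r : load D a U u b r <= 1.
Proof. by rewrite /load; case: ifP => // _; rewrite ge_min lexx. Qed.

(** Two cells meeting a set of width [u] have indices that differ by at most
    [u / h + 1] in each direction. *)
Lemma card_cells_meeting M b (h u : R) (A : pred {ffun 'I_s -> 'I_M}) U :
  0 < h -> 0 <= u -> small_width U u ->
  (forall c, A c -> exists2 x, U x &
     forall j, b j + (c j)%:R * h <= x 0 j <= b j + (c j)%:R * h + h) ->
  #|A|%:R <= (u / h + 2) ^+ s.
Proof.
move=> h0 u0 Uu AU; pose D := Num.trunc (u / h + 1).
have uh0 : 0 <= u / h by rewrite divr_ge0 // ltW.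
pose f (c : {ffun 'I_s -> 'I_M}) : {ffun 'I_s -> 'I_D.+1} := [ffun j => inord (c j %% D.+1)].
have f_inj : {in A &, injective f}.
  have close c c' j : A c -> A c' -> (c j <= c' j + D)%N.
    move=> /AU[x Ux xc] /AU[y Uy yc]; have [cc'|c'c] := leqP (c j) (c' j).
      by rewrite (leq_trans cc') ?leq_addr.
    rewrite -leq_subLR truncn_ge_nat ?addr_ge0 // (natrB _ (ltnW c'c)).
    have -> : u / h + 1 = (u + h) / h by rewrite mulrDl divff ?gt_eqF.
    rewrite ler_pdivlMr // mulrBl.
    have := Uu x y Ux Uy j; have := xc j; have := yc j; rewrite ler_norml; lra.
  move=> c c' Ac Ac' fcc'; apply/ffunP => j; apply/val_inj.
  apply: (modn_inj_close (close _ _ j Ac Ac') (close _ _ j Ac' Ac)).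
  have := congr1 (fun g : {ffun 'I_s -> 'I_D.+1} => val (g j)) fcc'.
  by rewrite !ffunE /= !inordK ?ltn_mod.
rewrite -(card_in_image f_inj); apply: (@le_trans _ _ ((D.+1 ^ s)%N%:R)).
  by rewrite ler_nat (leq_trans (max_card _)) // card_ffun !card_ord.
rewrite natrX lerXn2r ?nnegrE ?addr_ge0 // -natr1.
by have := truncn_le (u / h + 1); rewrite -/D addr_ge0 //; lra.
Qed.

(** The average load of the children of a cube is at most its own load.  Below
    the side [h] of the cells, [U] meets at most [3^s] children, and the
    smallness of [r'], which expresses that the children are numerous enough for
    the exponent [a], compensates for the loss of scale.  Above [h], the
    proportion of children that [U] meets is at most [2 (3 u / r)^s], and this
    is at most the load of the cube because [a <= s]; the factor [2 * 3^s] in the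
    load is chosen for this case and is the same at all levels, so that nothing
    is lost from one level to the next. *)
Lemma sum_load_children M b r r' a U u (G : pred {ffun 'I_s -> 'I_M})
    (child : {ffun 'I_s -> 'I_M} -> 'I_s -> R) :
  (0 < M)%N -> 0 < r -> 0 < r' -> 0 <= a <= s%:R -> 0 < u -> small_width U u ->
  (forall c, G c -> forall x, cube (child c) r' x -> forall j,
     b j + (c j)%:R * (r / M%:R) <= x 0 j <= b j + (c j)%:R * (r / M%:R) + r / M%:R) ->
  (M ^ s <= 2 * #|G|)%N -> 2 * 3 ^+ s * (r / r') `^ a <= M%:R ^+ s ->
  \sum_(c | G c) load (2 * 3 ^+ s) a U u (child c) r' <= #|G|%:R * load (2 * 3 ^+ s) a U u b r.
Proof.
move=> M0 r0 r'0 /andP[a0 a_s] u0 Uu child_cell cardG r'_small.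
set h := r / M%:R in child_cell *; set D := 2 * 3 ^+ s in r'_small *.
have MR0 : 0 < M%:R :> R by rewrite ltr0n.
have h0 : 0 < h by rewrite divr_gt0.
have Mh : M%:R * h = r by rewrite mulrC divfK ?gt_eqF.
have D0 : 0 < D by rewrite mulr_gt0 // exprn_gt0.
have cardGR : M%:R ^+ s <= 2 * #|G|%:R :> R by rewrite -natrX -natrM ler_nat.
pose A : pred {ffun 'I_s -> 'I_M} := [pred c | G c && `[< cube (child c) r' `&` U !=set0 >]].
have child_sub c : G c -> cube (child c) r' `<=` cube b r.
  move=> Gc x cx j; have /andP[lo hi] := child_cell c Gc x cx j.
  have c1 : (c j)%:R + 1 <= M%:R :> R by rewrite natr1 ler_nat.
  have ch : 0 <= (c j)%:R * h by rewrite mulr_ge0 // ltW.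
  have : ((c j)%:R + 1) * h <= r by rewrite -Mh ler_wpM2r // ltW.
  rewrite mulrDl mul1r; lra.
have sumA v : (forall c, A c -> load D a U u (child c) r' <= v) ->
    \sum_(c | G c) load D a U u (child c) r' <= #|A|%:R * v.
  move=> Av; rewrite mulr_natl -sumr_const big_mkcond [leRHS]big_mkcond /=.
  apply: ler_sum => c _; have [Gc|nGc] := boolP (G c); last by rewrite inE (negbTE nGc).
  rewrite inE; case: ifP => [Ac|]; first exact: Av.
  by rewrite Gc /= /load => ->.
have [[z [bz Uz]]|nU] := pselect (cube b r `&` U !=set0); last first.
  rewrite big1 ?mulr_ge0 ?load_ge0 ?(ltW D0) // => c Gc; rewrite /load asboolF //.
  by move=> [x [cx Ux]]; apply: nU; exists x; split => //; exact: child_sub Gc _ cx.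
have -> : load D a U u b r = Num.min 1 (D * (u / r) `^ a).
  by rewrite /load asboolT //; exists z.
have [_|small] := leP 1 (D * (u / r) `^ a).
  rewrite mulr1 -sum1_card natr_sum; apply: ler_sum => c _; exact: load_le1.
have cardA : #|A|%:R <= (u / h + 2) ^+ s.
  apply: (card_cells_meeting (b := b) (U := U)) => // [|c /andP[Gc /asboolP[x [cx Ux]]]].
    exact: ltW.
  by exists x => //; exact: child_cell Gc _ cx.
have uh0 : 0 < u / h by rewrite divr_gt0.
have ur0 : 0 < u / r by rewrite divr_gt0.
have [uh|hu] := leP u h.
  apply: (le_trans (sumA (D * (u / r') `^ a) _)).
    by move=> c /andP[_ cU]; rewrite /load cU ge_min lexx orbT.
  have -> : (u / r') `^ a = (u / r) `^ a * (r / r') `^ a.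
    by rewrite -powRM ?divr_ge0 ?ltW // mulrA divfK ?gt_eqF.
  have cardA3 : #|A|%:R <= 3 ^+ s :> R.
    apply: (le_trans cardA); rewrite lerXn2r ?nnegrE ?addr_ge0 ?(ltW uh0) //.
    have uh1 : u / h <= 1 by rewrite ler_pdivrMr // mul1r.
    lra.
  have ura : 0 <= D * (u / r) `^ a by rewrite mulr_ge0 ?powR_ge0 // ltW.
  have Z0 : 0 <= (r / r') `^ a by exact: powR_ge0.
  have AZ : #|A|%:R * (r / r') `^ a <= #|G|%:R.
    apply: (le_trans (ler_wpM2r Z0 cardA3)).
    by move: (le_trans r'_small cardGR); rewrite /D -mulrA ler_pM2l.
  have rearrange (x d y z' : R) : x * (d * (y * z')) = x * z' * (d * y) by ring.
  rewrite rearrange.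
  exact: ler_wpM2r.
apply: (le_trans (sumA 1 _)); first by move=> c _; exact: load_le1.
rewrite mulr1; apply: (le_trans cardA).
have D1 : 1 <= D by rewrite /D mulr_ege1 ?ler1n // exprn_ege1 // ler1n.
have ur1 : u / r <= 1.
  rewrite leNgt; apply/negP => /ltW ur1; move: small; apply/negP; rewrite -leNgt.
  by rewrite mulr_ege1 // -(powRr0 (u / r)) ler_powR.
apply: (@le_trans _ _ ((3 * (u / h)) ^+ s)).
  have uh1 : 1 < u / h by rewrite ltr_pdivlMr // mul1r.
  by apply: lerXn2r; rewrite ?nnegrE; lra.
have -> : u / h = M%:R * (u / r) by rewrite /h; field; rewrite !gt_eqF.
rewrite exprMn exprMn /D.
have rearrange (x y z' : R) : x * (2 * y * z') = y * (2 * x * z') by ring.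
rewrite rearrange ler_wpM2l ?exprn_ge0 //.
apply: ler_pM; rewrite ?exprn_ge0 ?(ltW ur0) //.
by rewrite -powR_mulrn ?(ltW ur0) // ger_powR // ur0.
Qed.

End CubeLoad.

Definition total_load (R : realType) (s : nat) (D a : R) (U : nat -> set 'rV[R]_s)
    (u : nat -> R) (b : 'I_s -> R) (r : R) : \bar R :=
  (\sum_(0 <= i <oo) (load D a (U i) (u i) b r)%:E)%E.

Lemma exists_child_le_load (R : realType) (s M : nat) (D a : R) (U : nat -> set 'rV[R]_s)
    (u : nat -> R) (b : 'I_s -> R) (r r' : R) (G : pred {ffun 'I_s -> 'I_M})
    (child : {ffun 'I_s -> 'I_M} -> 'I_s -> R) :
  0 <= D -> (0 < #|G|)%N ->
  (forall i, \sum_(c | G c) load D a (U i) (u i) (child c) r' <=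
    #|G|%:R * load D a (U i) (u i) b r) ->
  (total_load D a U u b r < 1)%E ->
  exists2 c, G c & (total_load D a U u (child c) r' < 1)%E.
Proof.
move=> D0 G0 children lt1; apply: contrapT => none.
have GR0 : 0 < #|G|%:R :> R by rewrite ltr0n.
have ge1 c : G c -> (1 <= total_load D a U u (child c) r')%E.
  by move=> Gc; rewrite leNgt; apply/negP => lt; apply: none; exists c.
have : (#|G|%:R%:E <= \sum_(c | G c) total_load D a U u (child c) r')%E.
  rewrite -sum1_card natr_sum -sumEFin; apply: lee_sum => c Gc; exact: ge1.
rewrite /total_load -nneseries_sum; last by move=> c i _; rewrite lee_fin load_ge0.
apply/negP; rewrite -ltNge.
apply: (@le_lt_trans _ _ (\sum_(0 <= i <oo) (#|G|%:R%:E * (load D a (U i) (u i) b r)%:E))%E).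
  apply: lee_nneseries => i *.
    by apply: sume_ge0 => c _; rewrite lee_fin load_ge0.
  by rewrite sumEFin -EFinM lee_fin.
rewrite nneseriesZl; last by move=> i _; rewrite lee_fin load_ge0.
by rewrite -[ltRHS]mule1 lte_pmul2l // lte_fin.
Qed.

(** * Lower bound for the dimension *)

(** The children of a cube are the cubes of side [(n^s)^(-mu-1)] centred at
    rational points provided by [many_good_cells].  The condition
    [r' <= h / 4] keeps them in their cells and follows from [mu >= 1/s]; the
    condition on their number is [n^(s(mu+1)a)] against [n^(s(s+1))], up to a
    constant depending on [r], and holds for large [n] as
    [(mu + 1) a < s + 1]. *)
Lemma load_step (R : realType) (s : nat) (mu a : R) : (0 < s)%N -> s%:R^-1 <= mu ->
  0 <= a < (s%:R + 1) / (mu + 1) ->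
  forall (r : R) (N : nat), 0 < r <= 1 ->
  exists r', [/\ 0 < r' <= 1, r' <= N.+1%:R^-1 &
    forall b (U : nat -> set 'rV[R]_s) u,
      (forall i, 0 < u i) -> (forall i, small_width (U i) (u i)) ->
      (total_load (2 * 3 ^+ s) a U u b r < 1)%E ->
      exists b', [/\ cube b' r' `<=` cube b r,
        (total_load (2 * 3 ^+ s) a U u b' r' < 1)%E &
        forall x, cube b' r' x -> exists q (p : 'I_s -> int), (N < q)%N /\
          forall j, `|q%:R * x 0 j - (p j)%:~R| <= q%:R `^ (- mu)]].
Proof.
move=> s0 mu_s /andP[a0 a_lt] r N r01; have /andP[r0 r1] := r01.
have sR0 : 0 < s%:R :> R by rewrite ltr0n.
have mu0 : 0 < mu by apply: lt_le_trans mu_s; rewrite invr_gt0.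
have mu1 : 0 < mu + 1 by lra.
have smu : 1 <= s%:R * mu by rewrite -ler_pdivrMl // mulr1.
have a_mu : (mu + 1) * a < s%:R + 1 by rewrite mulrC -ltr_pdivlMr.
have a_s : 0 <= a <= s%:R.
  rewrite a0 /= (le_trans (ltW a_lt)) // ler_pdivrMr // mulrDr mulr1 addrC lerD2r //.
have [n0 good] := many_good_cells s0 r01; move: good; set K := (4 * 20 ^ s)%N => good.
have K0 : (0 < K)%N by rewrite muln_gt0 expn_gt0.
clearbody K.
have KR0 : 0 < K%:R :> R by rewrite ltr0n.
pose x0 := s%:R * (s%:R + 1 - (mu + 1) * a).
have x0_gt0 : 0 < x0 by rewrite mulr_gt0 // subr_gt0.
have [N2 N2P] := powR_eventually_gt (2 * 3 ^+ s * (8 * K%:R / r) ^+ s) x0_gt0.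
pose n := (n0 + N2 + K * N.+1).+1.
have n_n0 : (n0 <= n)%N by rewrite /n -!addnA ltnW // ltnS leq_addr.
have n_N2 : (N2 < n)%N by rewrite /n ltnS -addnA addnCA leq_addr.
have n_KN : (K * N.+1 <= n)%N by rewrite /n ltnW // ltnS leq_addl.
have n_pos : (0 < n)%N by [].
clearbody n.
have nR0 : 0 < n%:R :> R by rewrite ltr0n.
have nR1 : 1 <= n%:R :> R by rewrite ler1n.
have ns_ge : (n <= n ^ s)%N by rewrite -{1}(expn1 n) leq_pexp2l.
have nsR0 : 0 < (n ^ s)%:R :> R by rewrite ltr0n expn_gt0 n_pos.
have nsR1 : 1 <= (n ^ s)%:R :> R by rewrite ler1n expn_gt0 n_pos.
have := good n n_n0; set X := r * _ / _; set M := Num.trunc X; move=> [M0 goodM].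
have MR0 : 0 < M%:R :> R by rewrite ltr0n.
have X0 : 0 <= X by rewrite divr_ge0 // mulr_ge0 ?exprn_ge0 // ltW.
have MX : M%:R <= X by rewrite truncn_le.
have XM : X <= 2 * M%:R.
  have : X < M%:R + 1 by rewrite natr1 truncnS_gt.
  have : 1 <= M%:R :> R by rewrite ler1n.
  lra.
pose r' := (n ^ s)%:R `^ (- (mu + 1)) : R.
have r'0 : 0 < r' by rewrite powR_gt0.
pose h := r / M%:R.
have h0 : 0 < h by rewrite divr_gt0.
have W0 : 0 < n%:R ^+ s.+1 :> R by rewrite exprn_gt0.
have h_ge : 4 * K%:R / n%:R ^+ s.+1 <= h.
  rewrite /h ler_pdivlMr // mulrAC ler_pdivrMr //.
  by move: MX; rewrite /X natrM ler_pdivlMr ?mulr_gt0 // mulrC.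
have r'_n : r' <= (n%:R ^+ s.+1)^-1.
  rewrite /r' natrX -powR_mulrn // -powRrM -powR_mulrn // -powRN ler_powR //.
  by rewrite -natr1; lra.
have K1 : 1 <= K%:R :> R by rewrite ler1n.
have r'_h : r' <= h / 4.
  apply: (le_trans r'_n); rewrite ler_pdivlMr // (le_trans _ h_ge) //.
  by rewrite mulrC ler_wpM2r ?invr_ge0 ?(ltW W0) // ler_peMr.
exists r'; split.
- rewrite r'0 (le_trans r'_n) // invf_le1 ?exprn_gt0 // exprn_ege1 //.
- apply: (le_trans r'_n); rewrite lef_pV2 ?posrE ?exprn_gt0 ?ltr0n //.
  rewrite -natrX ler_nat (@leq_trans n) //; first by rewrite (leq_trans _ n_KN) // leq_pmull.
  by rewrite -{1}(expn1 n) leq_pexp2l.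
move=> b U u u0 Uu lt1.
pose G : pred {ffun 'I_s -> 'I_M} := [pred c | `[< good_cell K n b h c >]].
have ex (c : {ffun 'I_s -> 'I_M}) : exists qp : nat * ('I_s -> int), G c ->
    [/\ (n ^ s < qp.1 * K)%N, (qp.1 <= n ^ s)%N &
     forall j, `|qp.1%:R * cell_center b h c j - (qp.2 j)%:~R| <= n%:R^-1].
  have [/asboolP[q [p qpP]]|nG] := boolP (G c); first by exists (q, p).
  by exists (0%N, fun=> 0).
have [qp qpP] := choice ex.
pose child c j := ((qp c).2 j)%:~R / (qp c).1%:R - r' / 2.
have cardG : (M ^ s <= 2 * #|G|)%N by exact: goodM.
have G0 : (0 < #|G|)%N.
  by have := leq_trans _ cardG; move=> /(_ 1%N); rewrite expn_gt0 M0 muln_gt0 => /(_ isT).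
have child_cell c : G c -> forall x, cube (child c) r' x -> forall j,
     b j + (c j)%:R * h <= x 0 j <= b j + (c j)%:R * h + h.
  move=> Gc x xc j; have [qK qn close] := qpP c Gc.
  have := xc j; rewrite /child; set p := (qp c).2 j; set q := (qp c).1 in qK qn *.
  have q0 : (0 < q)%N by case: (q) qK.
  have qR0 : 0 < q%:R :> R by rewrite ltr0n.
  have : `|cell_center b h c j - p%:~R / q%:R| <= h / 4.
    have -> : cell_center b h c j - p%:~R / q%:R = (q%:R * cell_center b h c j - p%:~R) / q%:R.
      by rewrite mulrBl [q%:R * _]mulrC mulfK ?gt_eqF.
    rewrite normrM normfV (ger0_norm (ltW qR0)) ler_pdivrMr // (le_trans (close j)) //.
    rewrite -div1r ler_pdivrMr // -(ler_pM2r (_ : 0 < 4)) // mul1r.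
    have -> : h / 4 * q%:R * n%:R * 4 = h * (q%:R * n%:R) by field.
    apply: (@le_trans _ _ (4 * K%:R / n%:R ^+ s.+1 * (q%:R * n%:R))); last first.
      by rewrite ler_wpM2r ?mulr_ge0.
    have -> : 4 * K%:R / n%:R ^+ s.+1 * (q%:R * n%:R) = 4 * (q%:R * K%:R / n%:R ^+ s) :> R.
      by rewrite exprS; field; rewrite expf_neq0 gt_eqF.
    rewrite -[leLHS]mulr1 ler_pM2l // ler_pdivlMr ?exprn_gt0 // mul1r.
    by rewrite -natrM -natrX ler_nat ltnW.
  rewrite /cell_center ler_norml; move: r'_h; lra.
have r'_small : 2 * 3 ^+ s * (r / r') `^ a <= M%:R ^+ s.
  have rr' : (r / r') `^ a <= n%:R `^ (s%:R * (mu + 1) * a).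
    have -> : n%:R `^ (s%:R * (mu + 1) * a) = (r'^-1) `^ a.
      by rewrite /r' powRN invrK natrX -powR_mulrn // -!powRrM mulrA.
    have r'V : 0 < r'^-1 by rewrite invr_gt0.
    apply: ge0_ler_powR => //; rewrite ?nnegrE ?mulr_ge0 ?(ltW r0) ?(ltW r'V) //.
    by rewrite ler_piMl // ltW.
  apply: (le_trans (ler_wpM2l _ rr')); first by rewrite mulr_ge0 ?exprn_ge0.
  have rK0 : 0 < r / (8 * K%:R) by rewrite divr_gt0 // mulr_gt0.
  have M_ge : r / (8 * K%:R) * n%:R ^+ s.+1 <= M%:R.
    move: XM; rewrite /X natrM.
    have -> : r * n%:R ^+ s.+1 / (4 * K%:R) = 2 * (r / (8 * K%:R) * n%:R ^+ s.+1).
      by field; rewrite gt_eqF.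
    by rewrite ler_pM2l.
  apply: (@le_trans _ _ ((r / (8 * K%:R) * n%:R ^+ s.+1) ^+ s)); last first.
    by apply: lerXn2r; rewrite ?nnegrE // mulr_ge0 ?(ltW rK0) ?(ltW W0).
  rewrite exprMn -exprM.
  have -> : n%:R ^+ (s.+1 * s) = n%:R `^ x0 * n%:R `^ (s%:R * (mu + 1) * a) :> R.
    rewrite -powR_addr // -powR_mulrn // natrM -natr1; congr (_ `^ _); rewrite /x0; ring.
  rewrite mulrA ler_wpM2r ?powR_ge0 // -ler_pdivrMl ?exprn_gt0 // mulrC -exprVn.
  have -> : (r / (8 * K%:R))^-1 = 8 * K%:R / r by rewrite invf_div.
  exact: ltW (N2P n n_N2).
have D0 : 0 <= 2 * 3 ^+ s :> R by rewrite mulr_ge0 ?exprn_ge0.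
have loads i : \sum_(c | G c) load (2 * 3 ^+ s) a (U i) (u i) (child c) r' <=
    #|G|%:R * load (2 * 3 ^+ s) a (U i) (u i) b r.
  exact: (sum_load_children M0 r0 r'0 a_s (u0 i) (Uu i) child_cell cardG r'_small).
have [c Gc ltc] := exists_child_le_load D0 G0 loads lt1.
exists (child c); split=> //.
- move=> x xc j; have := child_cell c Gc x xc j.
  have c1 : (c j)%:R + 1 <= M%:R :> R by rewrite natr1 ler_nat.
  have ch : 0 <= (c j)%:R * h by rewrite mulr_ge0 // ltW.
  have : ((c j)%:R + 1) * h <= r by rewrite /h mulrA ler_pdivrMr // mulrC ler_pM2l.
  rewrite mulrDl mul1r; lra.
- move=> x xc; have [qK qn close] := qpP c Gc; exists (qp c).1, (qp c).2; split.
    rewrite -(ltn_pmul2r K0) (leq_ltn_trans _ qK) // (leq_trans _ ns_ge) //.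
    by rewrite (leq_trans _ n_KN) // mulnC leq_mul.
  move=> j; set q := (qp c).1 in qK qn *; set p := (qp c).2 j.
  have q0 : (0 < q)%N by case: (q) qK.
  have qR0 : 0 < q%:R :> R by rewrite ltr0n.
  have -> : q%:R * x 0 j - p%:~R = q%:R * (x 0 j - p%:~R / q%:R).
    by rewrite mulrBr [q%:R * (_ / _)]mulrC divfK ?gt_eqF.
  have xp : `|x 0 j - p%:~R / q%:R| <= r'.
    by have := xc j; rewrite /child -/q -/p ler_norml; move: r'0; lra.
  rewrite normrM ger0_norm // (le_trans (ler_wpM2l _ xp)) //.
  have -> : - mu = 1 + - (mu + 1) by ring.
  rewrite powR_addr // powRr1 // ler_pM2l // /r' !powRN lef_pV2 ?posrE ?powR_gt0 //.
  by apply: ge0_ler_powR; rewrite ?nnegrE ?ler_nat // ltW.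
Qed.
(** Iterating [load_step] from the unit cube gives nested cubes of side tending
    to 0 and load less than 1.  Their common point has exponent [mu]; and if it
    belonged to [U i], the load of [U i] would be 1 as soon as the side is less
    than [u i]. *)
Lemma exists_avoiding_point (R : realType) (s : nat) (mu a : R)
    (U : nat -> set 'rV[R]_s) (u : nat -> R) :
  (0 < s)%N -> s%:R^-1 <= mu -> 0 <= a < (s%:R + 1) / (mu + 1) ->
  (forall i, 0 < u i) -> (forall i, small_width (U i) (u i)) ->
  (total_load (2 * 3 ^+ s) a U u (fun=> 0%R) 1 < 1)%E ->
  exists2 x, approx_set mu x & forall i, ~ U i x.
Proof.
move=> s0 mu_s a_bnd u0 Uu load0; set D := 2 * 3 ^+ s in load0.
pose ok (st : ('I_s -> R) * R) := 0 < st.2 <= 1 /\ (total_load D a U u st.1 st.2 < 1)%E.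
have next (Nst : nat * (('I_s -> R) * R)) : exists st', ok Nst.2 ->
    [/\ ok st', cube st'.1 st'.2 `<=` cube Nst.2.1 Nst.2.2, st'.2 <= Nst.1.+1%:R^-1 &
      forall x, cube st'.1 st'.2 x -> exists q (p : 'I_s -> int), (Nst.1 < q)%N /\
          forall j, `|q%:R * x 0 j - (p j)%:~R| <= q%:R `^ (- mu)].
  case: Nst => N [b r] /=.
  have [[/= r01 lt1]|nok] := pselect (ok (b, r)); last by exists (b, r).
  have [r' [r'01 r'N step]] := load_step s0 mu_s a_bnd N r01.
  have [b' [sub lt1' close]] := step b U u u0 Uu lt1.
  exists (b', r') => _; split; [by split|exact: sub|exact: r'N|exact: close].
have [f fP] := choice next.
pose st := fix st k := if k is k'.+1 then f (k', st k') else (fun=> 0, 1).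
have st_ok k : ok (st k).
  elim: k => [|k IH]; last by have [] := fP (k, st k) IH.
  by split=> //=; rewrite ltr01 lexx.
have stP k := fP (k, st k) (st_ok k).
have nested k m : cube (st (k + m)%N).1 (st (k + m)%N).2 `<=` cube (st k).1 (st k).2.
  elim: m => [|m IH]; first by rewrite addn0.
  rewrite addnS; have [_ sub _ _] := stP (k + m)%N; exact: subset_trans sub IH.
pose corner k : 'rV[R]_s := \row_j (st k).1 j.
have corner_cube k : cube (st k).1 (st k).2 (corner k).
  by move=> j; rewrite mxE lexx /= lerDl; have [/andP[/ltW]] := st_ok k.
have corner_le k m j : (st k).1 j <= (st m).1 j + (st m).2.
  have [/subnKC km|/ltnW/subnKC mk] := leqP k m.
    have := nested k (m - k)%N _ (corner_cube _) j; rewrite km mxE => /andP[lo _].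
    by rewrite (le_trans lo) // lerDl; have [/andP[/ltW]] := st_ok m.
  by have := nested m (k - m)%N _ (corner_cube _) j; rewrite mk mxE => /andP[].
(* Each corner is below the upper end of every cube, so the supremum of the
   corners lies in all of them. *)
pose x : 'rV[R]_s := \row_j sup (range (fun k => (st k).1 j)).
have x_cube k : cube (st k).1 (st k).2 x.
  move=> j; rewrite mxE; apply/andP; split.
    apply: ub_le_sup; last by exists k.
    by exists ((st 0%N).1 j + (st 0%N).2) => _ [m _ <-]; exact: corner_le.
  apply: ge_sup; first by exists ((st 0%N).1 j); exists 0%N.
  by move=> _ [m _ <-]; exact: corner_le.
exists x.
  apply/approx_setP => eps eps0 N; have [_ _ _ close] := stP N.
  have [q [p [Nq qp]]] := close x (x_cube N.+1); exists q => //; exists p => j.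
  apply: (le_trans (qp j)); apply: ler_powR.
    by rewrite ler1n (leq_ltn_trans _ Nq).
  by rewrite lerDl ltW.
move=> i Uix.
have [N Nu] : exists N : nat, N.+1%:R^-1 <= u i.
  exists (Num.trunc (u i)^-1); rewrite -[leRHS]invrK lef_pV2 ?posrE ?invr_gt0 //.
  by apply/ltW; exact: truncnS_gt.
have [[/andP[r0 _] lt1] _ rN _] := stP N; move: lt1; apply/negP; rewrite -leNgt.
set b := (f _).1 in r0 rN *; set r := (f _).2 in r0 rN *.
have loadi : load D a (U i) (u i) b r = 1.
  rewrite /load asboolT; last by exists x; split => //; exact: (x_cube N.+1).
  apply/min_idPl; rewrite mulr_ege1 //.
    by rewrite /D mulr_ege1 ?ler1n // exprn_ege1 // ler1n.
  have /andP[a0 _] := a_bnd.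
  rewrite -(powRr0 (u i / r)) ler_powR // ler_pdivlMr // mul1r.
  exact: le_trans rN Nu.
have D0 : 0 <= D by rewrite /D mulr_ge0 ?exprn_ge0.
rewrite /total_load; apply: le_trans (nneseries_lim_ge i.+1 _); last first.
  by move=> m _ _; rewrite lee_fin load_ge0.
rewrite big_nat_recr //= loadi leeDr //.
by apply: sume_ge0 => m _; rewrite lee_fin load_ge0.
Qed.

(** If the measure were 0, the projections of a cover with small sum would have
    a total load less than 1 in the unit cube, and [exists_avoiding_point] would
    contradict that they cover.  Since the argument needs positive widths, and
    single points have diameter 0, the weight of the [i]-th set is first
    increased by [eta / 2^(i+1)]; and the exponent [a0], which may be 0, is
    replaced by a slightly larger one, which only decreases the weights of sets of
    diameter at most 1. *)
Lemma hausdorff_measure_approx_neq0 (R : realType) (s k : nat) (mu a0 : R)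
    (E : set 'rV[R]_k) (proj : 'rV[R]_k -> 'rV[R]_s) :
  (0 < s)%N -> s%:R^-1 <= mu -> 0 <= a0 < (s%:R + 1) / (mu + 1) ->
  (forall x y j, `|proj x 0 j - proj y 0 j| <= eucl_dist x y) ->
  approx_set mu `<=` proj @` E -> hausdorff_measure a0 E <> 0%E.
Proof.
move=> s0 mu_s /andP[a00 a0_lt] proj_contract approxE E0.
pose a := (a0 + (s%:R + 1) / (mu + 1)) / 2.
have [a_gt0 a0a a_lt] : [/\ 0 < a, a0 <= a & a < (s%:R + 1) / (mu + 1)].
  by split; rewrite /a; lra.
set D := 2 * 3 ^+ s : R; have D0 : 0 < D by rewrite mulr_gt0 ?exprn_gt0.
pose eta := (2 * D)^-1; have eta0 : 0 < eta by rewrite invr_gt0 mulr_gt0.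
have : (hausdorff_premeasure a0 1 E < eta%:E)%E.
  by rewrite (le_lt_trans (hausdorff_premeasure_le_measure _ _ ltr01)) // E0 lte_fin.
move=> /ereal_inf_lt[_ [U [U1 EU] <-] sumU].
have dp1 i : (diam_pow a0 (U i) <= 1%:E)%E.
  rewrite (le_trans (diam_pow_le a00 _ (U1 i))) ?powR1 //.
have dpE i : (fine (diam_pow a0 (U i)))%:E = diam_pow a0 (U i).
  rewrite fineK // ge0_fin_numE ?diam_pow_ge0 //.
  exact: le_lt_trans (dp1 i) (ltry _).
pose w i := fine (diam_pow a0 (U i)) + eta / (2 ^ i.+1)%:R.
have w0 i : 0 < w i.
  by rewrite ltr_wpDl ?fine_ge0 ?diam_pow_ge0 // divr_gt0 // ltr0n expn_gt0.
pose u i := w i `^ a^-1.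
have u0 i : 0 < u i by exact: powR_gt0.
pose T i := proj @` U i.
have Tu i : small_width (T i) (u i).
  move=> _ _ [x Ux <-] [y Uy <-] j; apply: (le_trans (proj_contract x y j)).
  set d := eucl_dist x y; have d0 : 0 <= d by exact: sqrtr_ge0.
  have d1 : d <= 1.
    rewrite -lee_fin (le_trans _ (U1 i)) //.
    by apply: ereal_sup_ubound; exists x => //; exists y.
  have dw : d `^ a <= w i.
    apply: (@le_trans _ _ (fine (diam_pow a0 (U i)))); last by rewrite lerDl divr_ge0 // ltW.
    rewrite -lee_fin dpE (le_trans _ (diam_pow_ge a00 Ux Uy)) // lee_fin -/d.
    move: d0; rewrite le_eqVlt => /predU1P[<-|d0].
      by rewrite powR0 ?gt_eqF // powR_ge0.
    by rewrite ger_powR // d0.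
  rewrite -[leLHS](powRr1 d0) -[X in d `^ X](mulfV (lt0r_neq0 a_gt0)) powRrM.
  by apply: ge0_ler_powR; rewrite ?nnegrE ?powR_ge0 ?invr_ge0 // ltW.
have load1 : (total_load D a T u (fun=> 0%R) 1 < 1)%E.
  apply: (@le_lt_trans _ _ (\sum_(0 <= i <oo)
     (D%:E * (diam_pow a0 (U i) + (eta / (2 ^ i.+1)%:R)%:E)))%E).
    apply: lee_nneseries => i *; first by rewrite lee_fin load_ge0 // ltW.
    rewrite -dpE -EFinD -EFinM lee_fin -/(w i) /load divr1.
    case: ifP => _; last by rewrite mulr_ge0 // ltW.
    have -> : u i `^ a = w i by rewrite /u -powRrM mulVf ?gt_eqF // powRr1 // ltW.
    by rewrite ge_min lexx orbT.
  rewrite nneseriesZl; last first.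
    by move=> i _; rewrite adde_ge0 ?diam_pow_ge0 // lee_fin divr_ge0 // ltW.
  apply: (@le_lt_trans _ _ (D%:E * (\sum_(0 <= i <oo) diam_pow a0 (U i) + eta%:E))%E).
    rewrite lee_pmul2l // ?lte_fin //.
    by apply: epsilon_trick => [i|]; [exact: diam_pow_ge0|exact: ltW].
  apply: (@lt_le_trans _ _ (D%:E * (eta%:E + eta%:E))%E).
    by rewrite lte_pmul2l // ?lte_fin // lteD2rE.
  rewrite -EFinD -EFinM lee_fin /eta.
  have -> : D * ((2 * D)^-1 + (2 * D)^-1) = 1 by field; rewrite gt_eqF.
  exact: lexx.
have a_bnd : 0 <= a < (s%:R + 1) / (mu + 1) by rewrite (ltW a_gt0).
have [x xmu xT] := exists_avoiding_point s0 mu_s a_bnd u0 Tu load1.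
have [y Ey yx] := approxE x xmu; have [i _ Uiy] := EU y Ey.
by apply: (xT i); exists y.
Qed.

(** * The theorem *)

Theorem theorem2p12 (R : realType) (s : nat) (s_gt0 : (0 < s)%N)
    (sigma : 'I_s -> nat) (sigma_gt0 : forall i, (0 < sigma i)%N)
    (P : forall i : 'I_s, (sigma i).-tuple {poly int})
    (P_first : forall i, (P i)`_0 = 'X)
    (P_deg : forall i, sorted leq [seq degp p | p <- P i])
    (lambda : R) (lambda_gt : (max_gap P)%:R < lambda) :
  let k := (\sum_(i < s) sigma i)%N in
  let d := min_last_deg P in
  let d' := max_last_deg P in
  let M := poly_manifold R P in
  let mu := d%:R * lambda + d%:R - 1 in
  let bound := ((s%:R + 1) / (d%:R * (lambda + 1)))%:E in
  [/\ proj_first sigma_gt0 @` (@approx_set R k lambda `&` M)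
        `<=` @approx_set R s mu,
      (hausdorff_dim (@approx_set R k lambda `&` M) <= bound)%E
    & d = d' ->
      proj_first sigma_gt0 @` (@approx_set R k lambda `&` M)
        = @approx_set R s mu
      (* Automatic when [1 < d'] (then [1 <= max_gap P < lambda]); when all
         degrees are 1 and [lambda < 1 / s] the approximation set is the whole
         space by Dirichlet's theorem, and the formula would exceed [s]. *)
      /\ (s%:R^-1 <= lambda ->
          hausdorff_dim (@approx_set R k lambda `&` M) = bound)].
Proof.
move=> k d d' M mu bound.
have lambda0 : 0 < lambda by apply: le_lt_trans lambda_gt.
have d0 : (0 < d)%N by exact: min_last_deg_gt0.
have dR1 : 1 <= d%:R :> R by rewrite ler1n.
have dR0 : 0 < d%:R :> R by rewrite ltr0n.
have mu1 : mu + 1 = d%:R * (lambda + 1) by rewrite /mu; ring.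
have lambda_mu : lambda <= mu.
  by rewrite -(lerD2r 1) mu1 ler_peMl // addr_ge0 // ltW.
have proj_point (x : 'rV[R]_s) : proj_first sigma_gt0 (poly_point P x) = x.
  exact: proj_first_poly_point.
have image_sub : approx_set lambda `&` M `<=` poly_point P @` approx_set mu.
  move=> z [appr [x _ zE]]; rewrite -zE in appr *; exists x => //.
  exact: approx_set_poly_point_sub appr.
have proj_sub : proj_first sigma_gt0 @` (approx_set lambda `&` M) `<=` approx_set mu.
  by move=> _ [z /image_sub[x xmu <-] <-]; rewrite proj_point.
have dim_le : (hausdorff_dim (approx_set lambda `&` M) <= bound)%E.
  apply: hausdorff_dim_le => [|a a_gt].
    by rewrite divr_ge0 ?addr_ge0 // -mu1; lra.
  apply/eqP; rewrite eq_le hausdorff_measure_ge0 andbT.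
  apply: (le_trans (le_hausdorff_measure _ image_sub)).
  rewrite hausdorff_measure_image_approx_set ?mu1 //.
    exact: poly_point_locally_lipschitz.
  exact: lt_le_trans lambda_mu.
split=> // dd'.
have proj_sup : approx_set mu `<=` proj_first sigma_gt0 @` (approx_set lambda `&` M).
  move=> x xmu; exists (poly_point P x); last exact: proj_point.
  split; last by exists x.
  apply: approx_set_poly_point_sup xmu => // i j; rewrite -/d dd'.
  apply: leq_trans (max_last_deg_ge P i); apply: (degp_nondecreasing P_deg).
  by rewrite ltn_predL sigma_gt0 andbT -ltnS prednK.
split=> [|s_lambda]; first by apply/seteqP; split.
apply/eqP; rewrite eq_le dim_le /=; apply: hausdorff_dim_ge => a; rewrite -mu1 => a_lt.
apply: hausdorff_measure_approx_neq0 a_lt _ proj_sup => //.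
  exact: le_trans lambda_mu.
by move=> x y i; rewrite !mxE; exact: le_eucl_dist.
Qed.
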